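(* Let $m_0\le n_0$ be integers and let $A,B\in\widetilde\Xi([m_0,n_0])$ with $co(A)=ro(B)$. Then there exist matrices $X_1,\dots,X_s\in\widetilde\Xi([m_0,n_0])$, elements $P_1(v,v'),\dots,P_s(v,v')\in\mathcal Z_1$ and an integer $a_0\ge0$ such that $$[{}_a(A^{[m,n]})]\cdot[{}_a(B^{[m,n]})]=\sum_{i=1}^sP_i(v,v^{-a})[{}_a(X_i^{[m,n]})]$$ in $\mathcal K([m,n],\sigma(A)+a(n-m+1))$ for all $a\ge a_0$, $m\le m_0$ and $n\ge n_0$.
   Context: $v$ indeterminate, $\mathcal Z=\mathbb Z[v,v^{-1}]$. For integers $m\le n$, $\widetilde\Xi([m,n])$ is the set of integer matrices $(a_{ij})_{i,j\in[m,n]}$ with $a_{ij}\ge0$ for $i\ne j$; $\Xi([m,n],r)$ the set of nonnegative integer such matrices with entry sum $\sigma(A)=r$; $ro(A)=(\sum_ja_{ij})_i$, $co(A)=(\sum_ia_{ij})_j$. For $A\in\widetilde\Xi([m_0,n_0])$, $m\le m_0$, $n\ge n_0$ and $a\in\mathbb Z$, ${}_a(A^{[m,n]})$ denotes the $[m,n]\times[m,n]$ matrix obtained by extending $A$ by zeros and adding $aI_{[m,n]}$ (so for $a$ large it lies in $\Xi([m,n],\sigma(A)+a(n-m+1))$). $\mathcal K([m,n],r)$: for a finite field with $q$ elements and an $r$-dimensional space $V$ over it, an $[m,n]$-step flag is $V_m\subseteq\cdots\subseteq V_n=V$, with $V_{m-1}:=0$. The $GL(V)$-orbits $\mathcal O_A$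 on pairs of flags $((V_i),(V'_i))$ correspond bijectively to $A\in\Xi([m,n],r)$ via $a_{ij}=\dim(V_{i-1}+V_i\cap V'_j)-\dim(V_{i-1}+V_i\cap V'_{j-1})$. For $(f_1,f_2)\in\mathcal O_C$ the number of flags $f$ with $(f_1,f)\in\mathcal O_A$, $(f,f_2)\in\mathcal O_B$ equals $g_{A,B,C}|_{v^2=q}$ for a polynomial $g_{A,B,C}\in\mathbb Z[v^2]$ independent of $q$. $\mathcal K([m,n],r)$ is the associative $\mathcal Z$-algebra, free with basis $\{e_A\}_{A\in\Xi([m,n],r)}$, with $e_Ae_B=\sum_Cg_{A,B,C}e_C$; $[A]:=v^{-d_A}e_A$ with $d_A=\sum_{i\ge k,j<l}a_{ij}a_{kl}$. $\mathcal Z_1$ is the subring of $\mathbb Q(v)[v']$ ($v'$ a new indeterminate) generated by all $v^j$ ($j\in\mathbb Z$) and all $\prod_{i=1}^t\frac{v^{-2(a-i)}v'^2-1}{v^{-2i}-1}$ with $a\in\mathbb Z$, $t\ge1$. *)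

(* Defs.v *)
From HB Require Import structures.
From mathcomp Require Import all_boot all_order all_algebra.
From mathcomp Require Import fraction.
From Stdlib Require Import ClassicalEpsilon.
Set Implicit Arguments. Unset Strict Implicit. Unset Printing Implicit Defensive.
Import Order.TTheory GRing.Theory Num.Theory.
Local Open Scope ring_scope.

(* A matrix indexed by [m,n] is encoded as a function int -> int -> int
   which vanishes outside [m,n] x [m,n]. *)
Definition mxZ := int -> int -> int.

Definition rng (m n : int) : seq int :=
  [seq m + (k%:Z) | k <- iota 0 (absz (n - m)).+1].

Definition inrng (m n i : int) : bool := (m <= i) && (i <= n).

Definition inXiT (m n : int) (A : mxZ) : Prop :=
  (forall i j, ~~ (inrng m n i && inrng m n j) -> A i j = 0) /\
  (forall i j, i != j -> 0 <= A i j).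

Definition sigmaZ (m n : int) (A : mxZ) : int :=
  \sum_(i <- rng m n) \sum_(j <- rng m n) A i j.
Definition roZ (m n : int) (A : mxZ) (i : int) : int := \sum_(j <- rng m n) A i j.
Definition coZ (m n : int) (A : mxZ) (j : int) : int := \sum_(i <- rng m n) A i j.

Definition inXi (m n r : int) (A : mxZ) : Prop :=
  (forall i j, ~~ (inrng m n i && inrng m n j) -> A i j = 0) /\
  (forall i j, 0 <= A i j) /\ sigmaZ m n A = r.

(* _a(A^{[m,n]}) : extend by zeros (A already vanishes outside its range)
   and add a I_{[m,n]} *)
Definition ext (a m n : int) (A : mxZ) : mxZ :=
  fun i j => A i j + (if (i == j) && inrng m n i then a else 0).

Definition eqZmx (m n : int) (A B : mxZ) : bool :=
  all (fun i => all (fun j => A i j == B i j) (rng m n)) (rng m n).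

Definition dmx (m n : int) (A : mxZ) : int :=
  \sum_(i <- rng m n) \sum_(j <- rng m n) \sum_(k <- rng m n) \sum_(l <- rng m n)
     (if (k <= i) && (j < l) then A i j * A k l else 0).

(* An [m,n]-step flag in F^r is V_m <= ... <= V_n = F^r; subspaces are
   represented by their canonical matrices (M = <<M>>), the flag by the
   finite function k |-> V_{m+k}, k = 0 .. n-m. *)
Definition flagT (F : finFieldType) (N r : nat) := {ffun 'I_N.+1 -> 'M[F]_r}.

Definition isflag (F : finFieldType) (N r : nat) (f : flagT F N r) : bool :=
  [forall k : 'I_N.+1, f k == (<< f k >>)%MS] &&
  [forall k : 'I_N, (f (widen_ord (leqnSn N) k) <= f (lift ord0 k))%MS] &&
  (1%:M <= f ord_max)%MS.

(* V_i for integer i, with V_{m-1} = 0 *)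
Definition flv (F : finFieldType) (m n : int) (r : nat)
    (f : flagT F (absz (n - m)) r) (i : int) : 'M[F]_r :=
  if inrng m n i then f (inord (absz (i - m))) else 0.

(* the matrix A with (f1,f2) in O_A:
   a_ij = dim(V_{i-1} + V_i \cap V'_j) - dim(V_{i-1} + V_i \cap V'_{j-1}) *)
Definition typ (F : finFieldType) (m n : int) (r : nat)
    (f1 f2 : flagT F (absz (n - m)) r) : mxZ :=
  fun i j =>
    if inrng m n i && inrng m n j then
      ((\rank (flv f1 (i - 1) + (flv f1 i :&: flv f2 j)))%MS%:Z
       - (\rank (flv f1 (i - 1) + (flv f1 i :&: flv f2 (j - 1))))%MS%:Z)
    else 0.

(* number of flags f with (f1,f) in O_A, (f,f2) in O_B, for (f1,f2) in O_C
   (computed as #triples / #pairs in O_C, which is the same number since it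
   does not depend on the choice of (f1,f2) in O_C) *)
Definition flagcount (m n : int) (r : nat) (A B C : mxZ) (F : finFieldType) : nat :=
  #|[set t : flagT F (absz (n - m)) r * flagT F (absz (n - m)) r
              * flagT F (absz (n - m)) r |
      [&& isflag t.1.1, isflag t.1.2, isflag t.2,
          eqZmx m n (typ t.1.1 t.1.2) A, eqZmx m n (typ t.1.2 t.2) B &
          eqZmx m n (typ t.1.1 t.2) C]]|
  %/ #|[set p : flagT F (absz (n - m)) r * flagT F (absz (n - m)) r |
      [&& isflag p.1, isflag p.2 & eqZmx m n (typ p.1 p.2) C]]|.

Definition is_gpoly (m n : int) (r : nat) (A B C : mxZ) (g : {poly int}) : Prop :=
  forall F : finFieldType, g.[(#|F|)%:Z] = (flagcount m n r A B C F)%:Z.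

Definition gpoly (m n : int) (r : nat) (A B C : mxZ) : {poly int} :=
  epsilon (inhabits 0) (is_gpoly m n r A B C).

Notation Qv := {fraction {poly rat}}.
Definition vv : Qv := FracField.tofrac ('X : {poly rat}).

(* coefficient of [C] in [A][B] in K([m,n],r), viewed in Q(v):
   [A][B] = v^{-d_A-d_B} sum_C g_{A,B,C}(v^2) v^{d_C} [C] *)
Definition Kcoef (m n : int) (r : nat) (A B C : mxZ) : Qv :=
  vv ^ (dmx m n C - dmx m n A - dmx m n B)
  * (map_poly (fun z : int => z%:~R : Qv) (gpoly m n r A B C)).[vv ^+ 2].

Definition Z1gen (a : int) (t : nat) : {poly Qv} :=
  \prod_(k < t)
     (((vv ^ (- 2 * (a - (k.+1)%:Z))) *: 'X^2 - 1)
      * ((vv ^ (- 2 * (k.+1)%:Z) - 1)^-1)%:P).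

Inductive inZ1 : {poly Qv} -> Prop :=
| Z1_v (j : int) : inZ1 (vv ^ j)%:P
| Z1_gen (a : int) (t : nat) : (0 < t)%N -> inZ1 (Z1gen a t)
| Z1_add p q : inZ1 p -> inZ1 q -> inZ1 (p + q)
| Z1_opp p : inZ1 p -> inZ1 (- p)
| Z1_mul p q : inZ1 p -> inZ1 q -> inZ1 (p * q).

(* Main.v *)
(* Relative positions of flags are second differences of the ranks of V_i :&: V'_j, and changing one
   step of a flag by one dimension moves one unit between two adjacent rows of the matrix, with an
   explicit number of choices.  These elementary moves generate: a nondiagonal A is obtained from a
   matrix A' with smaller sum of (i - j)^2 a_ij as the term of largest sum in the product of an
   elementary move with A', its coefficient being a quantum integer free of a.  By induction, every
   product is a finite combination of matrices X, with coefficients polynomial in q^a over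
   Z[q] localized at monic polynomials, of degree (len A + len B - len X) / 2 where
   len A is the sum of |i - j| a_ij.  Since d_{A + a I} = d_A + a len A, after normalization only
   nonnegative even powers of v' remain.  Integrality of the counts makes the structure constants
   polynomials over Z, and a polynomial in v'^2 over Q(v) whose values at v^{-a} are Laurent
   polynomials for all large a lies in Z_1, by Newton interpolation with Gaussian binomials. *)

(* The algebra itself is never constructed. A product is a convolution of rational functions on
   pairs of flags, so that associativity is an exchange of two sums, and the constancy of the count
   along an orbit is read off from the resulting expansion. The induction runs over all integers
   [a]: on pairs of flags [famM X] vanishes as soon as [ext a m n X] has a negative entry, so the
   bound [a0] is chosen only at the very end. The obstacle is that each step divides by the
   coefficient of the leading term. A divisor involving [a] would destroy polynomiality in q^a. The
   unit that is moved therefore lies off the diagonal, in a column such that the diagonal entry of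
   its row is not among the entries in the exponent. Even a divisor free of [a] leaves denominators
   q^k - 1, so the induction by itself proves no integrality, neither over Z[q] nor in Z_1. Both
   must be recovered from values. *)
Require Import Defs.
From HB Require Import structures.
From mathcomp Require Import all_boot all_order all_algebra.
From mathcomp Require Import fraction.
From mathcomp Require Import mxabelem zify ring.
From Stdlib Require Import FunctionalExtensionality ClassicalEpsilon.
Import Order.TTheory GRing.Theory Num.Theory.
Local Open Scope ring_scope.
Set Implicit Arguments. Unset Strict Implicit. Unset Printing Implicit Defensive.

(** * Sums over integer intervals *)

Section Ranges.
Implicit Types m n i j h u : int.

Lemma inrngP m n i : reflect (m <= i /\ i <= n) (inrng m n i).
Proof. exact: andP. Qed.

Lemma mem_rng m n i : m <= n -> (i \in rng m n) = inrng m n i.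
Proof.
move=> le_mn; apply/mapP/idP => [[k]|/inrngP[lmi lin]].
  rewrite mem_iota => hk ->; rewrite /inrng; lia.
by exists (absz (i - m)); [rewrite mem_iota; lia|lia].
Qed.

Lemma rng_uniq m n : uniq (rng m n).
Proof. by rewrite map_inj_uniq ?iota_uniq // => k l /addrI[]. Qed.

Lemma perm_rng_filter m n m' n' (P : pred int) : m <= n -> m' <= n' ->
  (forall i, inrng m n i -> P i -> inrng m' n' i) ->
  (forall i, inrng m' n' i -> inrng m n i && P i) ->
  perm_eq [seq i <- rng m n | P i] (rng m' n').
Proof.
move=> mn mn' h1 h2; apply: uniq_perm; rewrite ?filter_uniq ?rng_uniq // => i.
rewrite mem_filter !mem_rng //; apply/andP/idP => [[Pi mi]|/h2/andP[-> ->]] //.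
exact: h1.
Qed.

Lemma sum_rng_sub (V : nmodType) m n m0 n0 (f : int -> V) :
  m <= m0 -> m0 <= n0 -> n0 <= n -> (forall i, ~~ inrng m0 n0 i -> f i = 0) ->
  \sum_(i <- rng m n) f i = \sum_(i <- rng m0 n0) f i.
Proof.
move=> mm0 mn0 nn0 f0; rewrite (bigID (inrng m0 n0)) /= [X in _ + X]big1 ?addr0; last first.
  by move=> i /f0.
rewrite -big_filter; apply/perm_big/perm_rng_filter => //; first lia.
by move=> i; rewrite /inrng; lia.
Qed.

Lemma sum_rng1 (V : nmodType) m n u (x : V) : m <= n ->
  \sum_(i <- rng m n) (if i == u then x else 0) = if inrng m n u then x else 0.
Proof.
move=> mn; rewrite -mem_rng //; case: ifP => hu.
  by rewrite (bigD1_seq u) ?rng_uniq //= eqxx big1 ?addr0 // => i /negPf->.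
rewrite big1_seq // => i /andP[_ hi]; case: eqP => // iu.
by rewrite -iu hi in hu.
Qed.

Lemma rngSr m n : m <= n -> rng m (n + 1) = rcons (rng m n) (n + 1).
Proof.
move=> mn; rewrite /rng.
have -> : absz (n + 1 - m)%R = (absz (n - m)).+1 by lia.
rewrite -[in LHS]addn1 iotaD map_cat -cats1 /=; congr (_ :: _ ++ [:: _]); lia.
Qed.

Lemma rng1 m : rng m m = [:: m].
Proof. by rewrite /rng subrr /= addr0. Qed.

Lemma int_ind_ge (m : int) (P : int -> Prop) :
  P m -> (forall i, m <= i -> P i -> P (i + 1)) -> forall i, m <= i -> P i.
Proof.
move=> Pm IH i mi; rewrite -[i](subrK m) addrC.
have -> : i - m = (absz (i - m))%:Z by lia.
elim: (absz _) => [|k IHk]; first by rewrite addr0.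
by rewrite -addn1 PoszD addrA; apply: IH => //; lia.
Qed.

Lemma sum_rng_telescope m n (f : int -> int) : m <= n ->
  \sum_(i <- rng m n) (f i - f (i - 1)) = f n - f (m - 1).
Proof.
move: n; apply: int_ind_ge => [|n mn IH]; first by rewrite rng1 big_seq1.
rewrite rngSr // -cats1 big_cat /= IH big_seq1 addrK; ring.
Qed.

Lemma sum_rng_gt m n u (f : int -> int) : m <= n -> m - 1 <= u -> u <= n ->
  \sum_(i <- rng m n) (if u < i then f i - f (i - 1) else 0) = f n - f u.
Proof.
move=> mn mu un.
(* Freezing [f] at its value at [u] to the left of [u] turns the truncated sum into a full
   telescoping one. *)
transitivity (\sum_(i <- rng m n) (f (Order.max i u) - f (Order.max (i - 1) u))); last first.
  by rewrite (sum_rng_telescope (fun i => f (Order.max i u))) // max_l // max_r.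
apply: eq_big_seq => i; rewrite mem_rng // => /andP[mi ni].
case: ifP => ui; first by rewrite !max_l //; lia.
by rewrite !max_r ?subrr //; lia.
Qed.

Lemma sum_rng_lt m n u (f : int -> int) : m <= n -> m <= u -> u <= n + 1 ->
  \sum_(i <- rng m n) (if i < u then f i - f (i - 1) else 0) = f (u - 1) - f (m - 1).
Proof.
move=> mn mu un.
transitivity (\sum_(i <- rng m n) (f (Order.min i (u - 1)) - f (Order.min (i - 1) (u - 1))));
  last first.
  by rewrite (sum_rng_telescope (fun i => f (Order.min i (u - 1)))) // min_r ?min_l //; lia.
apply: eq_big_seq => i; rewrite mem_rng // => /andP[mi ni].
case: ifP => ui; first by rewrite !min_l //; lia.
by rewrite !min_r ?subrr //; lia.
Qed.

End Ranges.

(** * Counting lines and hyperplanes *)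

Lemma natrF_gt1 (F : finFieldType) : (1 : rat) < #|F|%:R.
Proof. by rewrite ltr1n card_finNzRing_gt1. Qed.

Lemma natrF_neq0 (F : finFieldType) : (#|F|%:R : rat) != 0.
Proof. by rewrite gt_eqF // (lt_trans ltr01) ?natrF_gt1. Qed.

Lemma natrF_sub1_neq0 (F : finFieldType) : (#|F|%:R : rat) - 1 != 0.
Proof. by rewrite subr_eq0 gt_eqF ?natrF_gt1. Qed.

Section Lines.
Variables (F : finFieldType) (r : nat).
Implicit Types P Q W : 'M[F]_r.

Definition lines_between P Q : {set 'M[F]_r} :=
  [set W | [&& W == <<W>>%MS, (P <= W)%MS, (W <= Q)%MS & \rank W == (\rank P).+1]].

Definition hyps_between P Q : {set 'M[F]_r} :=
  [set W | [&& W == <<W>>%MS, (P <= W)%MS, (W <= Q)%MS & (\rank W).+1 == \rank Q]].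

Lemma card_rowgD P W : (P <= W)%MS ->
  #|rowg W :\: rowg P| = (#|F| ^ \rank W - #|F| ^ \rank P)%N.
Proof.
move=> PW; rewrite cardsD !card_rowg; congr (_ - _)%N.
by rewrite -card_rowg; congr #|pred_of_set _|; apply/setIidPr; rewrite rowgS.
Qed.

(** A vector of [Q] outside [P] spans together with [P] exactly one such subspace [W], and [W] is
    obtained from all of its own vectors outside [P]. *)
Lemma card_lines_mul P Q : (P <= Q)%MS ->
  (#|lines_between P Q| * (#|F| ^ (\rank P).+1 - #|F| ^ \rank P)
   = #|F| ^ \rank Q - #|F| ^ \rank P)%N.
Proof.
move=> PQ; rewrite -card_rowgD // -[RHS]sum1_card.
have fP (x : 'rV[F]_r) : x \in rowg Q :\: rowg P -> <<(P + x)%MS>>%MS \in lines_between P Q.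
  rewrite !inE genmx_id eqxx /= !genmxE addsmxSl addsmx_sub PQ /= => /andP[xP ->] /=.
  rewrite eqn_leq; apply/andP; split.
    apply: (leq_trans (mxrank_adds_leqif _ _)); rewrite -[(\rank P).+1]addn1 leq_add2l.
    by rewrite (leq_trans (rank_leq_row _)).
  rewrite ltn_neqAle mxrankS ?addsmxSl // andbT.
  have [_ ->] := mxrank_leqif_sup (addsmxSl P x).
  by apply: contra xP; apply: submx_trans; apply: addsmxSr.
rewrite (partition_big (fun x => <<(P + x)%MS>>%MS) (mem (lines_between P Q))) //=.
rewrite -sum_nat_const; apply: eq_bigr => W; rewrite inE => /and4P[/eqP WW PW WQ /eqP rW].
rewrite sum1dep_card -rW -card_rowgD //; apply: eq_card => x.
rewrite !inE; case xP: (x <= P)%MS => //=; apply/idP/andP => [xW|[xQ /eqP <-]]; last first.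
  by rewrite genmxE addsmxSr.
split; first exact: submx_trans WQ.
rewrite eq_sym WW; apply/eqP/eq_genmx/eqmx_sym.
have sub : (P + x <= W)%MS by rewrite addsmx_sub PW.
apply/eqmxP; rewrite sub /=; have [_ <-] := mxrank_leqif_sup sub.
rewrite eqn_leq mxrankS //= rW ltn_neqAle mxrankS ?addsmxSl // andbT.
have [_ ->] := mxrank_leqif_sup (addsmxSl P x).
by apply: contraFN xP; apply: submx_trans; apply: addsmxSr.
Qed.

Lemma card_lines P Q : (P <= Q)%MS ->
  (#|lines_between P Q|%:R : rat)
  = ((#|F|%:R : rat) ^+ (\rank Q - \rank P) - 1) / (#|F|%:R - 1).
Proof.
move=> PQ; have := card_lines_mul PQ; have := mxrankS PQ.
move: (\rank P) (\rank Q) => p s ps.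
move=> /(congr1 (fun k => k%:R : rat)); rewrite natrM !natrB; last 2 first.
- by rewrite leq_exp2l // card_finNzRing_gt1.
- by rewrite leq_exp2l // card_finNzRing_gt1.
have q0 := natrF_neq0 F; have q1 := natrF_sub1_neq0 F.
rewrite !natrX => e.
have qp : (#|F|%:R : rat) ^+ p != 0 by rewrite expf_neq0.
rewrite exprSr in e; apply: (mulIf qp).
apply: (@mulIf _ (#|F|%:R - 1)); first by [].
have es : (#|F|%:R : rat) ^+ s = #|F|%:R ^+ (s - p) * #|F|%:R ^+ p by rewrite -exprD subnK.
rewrite es in e; rewrite -[LHS]mulrA [_ * (_ - 1)]mulrBr mulr1 e; field; exact: q1.
Qed.

(** The orthogonal for the standard bilinear form, normalized so that equal subspaces give equal
    matrices. *)
Definition orthmx W : 'M[F]_r := <<kermx W^T>>%MS.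

Lemma sub_orthmx k (x : 'M_(k, r)) W : (x <= orthmx W)%MS = (x *m W^T == 0).
Proof. by rewrite genmxE sub_kermx. Qed.

Lemma rank_orthmx W : \rank (orthmx W) = (r - \rank W)%N.
Proof. by rewrite genmxE mxrank_ker mxrank_tr. Qed.

Lemma orthmxK W : orthmx (orthmx W) = <<W>>%MS.
Proof.
rewrite {1}/orthmx; apply/eq_genmx/eqmx_sym/eqmxP.
have sub : (W <= kermx (orthmx W)^T)%MS.
  rewrite sub_kermx -trmx_eq0 trmx_mul trmxK.
  by rewrite -sub_orthmx.
rewrite sub; have [_ <-] := mxrank_leqif_sup sub.
by rewrite mxrank_ker mxrank_tr rank_orthmx subKn ?eqxx ?rank_leq_col.
Qed.

Lemma orthmxS P Q : (P <= Q)%MS -> (orthmx Q <= orthmx P)%MS.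
Proof.
move=> /submxP[D ->]; rewrite sub_orthmx trmx_mul mulmxA.
have /eqP-> : (orthmx Q *m Q^T == 0) by rewrite -sub_orthmx.
by rewrite mul0mx.
Qed.

(** Duality: [orthmx] reverses inclusions, is an involution on canonical matrices and replaces
    dimension by codimension. *)
Lemma card_hyps_lines P Q : (P <= Q)%MS ->
  #|hyps_between P Q| = #|lines_between (orthmx Q) (orthmx P)|.
Proof.
move=> PQ.
have rr W : (\rank W <= r)%N by apply: rank_leq_col.
rewrite -[LHS](card_in_imset (f := orthmx)); last first.
  move=> W W'; rewrite !inE => /and4P[/eqP e _ _ _] /and4P[/eqP e' _ _ _] /(congr1 orthmx).
  by rewrite !orthmxK -e -e'.
apply: eq_card => W; apply/imsetP/idP => [[W']|].
  rewrite !inE => /and4P[_ PW WQ /eqP rW] ->.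
  rewrite [X in _ == X]genmx_id eqxx !orthmxS // !rank_orthmx -rW /=.
  by have := rr Q; rewrite -rW; lia.
rewrite inE => /and4P[/eqP e QW WP /eqP rW]; exists (orthmx W); last by rewrite orthmxK.
have := rr Q; move: rW; rewrite inE [X in _ == X]genmx_id eqxx !rank_orthmx => rW.
have -> : (P <= orthmx W)%MS.
  by have := orthmxS WP; rewrite orthmxK; apply: submx_trans; rewrite genmxE.
have -> : (orthmx W <= Q)%MS.
  by have := orthmxS QW; rewrite orthmxK => /submx_trans; apply; rewrite genmxE.
rewrite /= rW; have := rr W; lia.
Qed.

Lemma card_hyps P Q : (P <= Q)%MS ->
  (#|hyps_between P Q|%:R : rat)
  = ((#|F|%:R : rat) ^+ (\rank Q - \rank P) - 1) / (#|F|%:R - 1).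
Proof.
move=> PQ; rewrite card_hyps_lines // card_lines ?orthmxS // !rank_orthmx.
have := rank_leq_col Q; have := mxrankS PQ => a b.
by congr ((_ ^+ _ - _) / _); lia.
Qed.

End Lines.

(** * Flags and their relative position *)

(** A unit entry is the first difference of a step function: [rkcap_adj] produces steps, [typ_adj]
    needs entries. *)
Lemma unit_step_diff (c : bool) (u j : int) : (if c && (j == u) then 1 else 0 : int)
  = (if c && (u <= j) then 1 else 0) - (if c && (u <= j - 1) then 1 else 0).
Proof. by case: c => //=; do 3![case: ifP => ?]; lia. Qed.

Section Flags.
Variables (F : finFieldType) (m n : int) (r : nat).
Hypothesis le_mn : m <= n.
Notation flag := (flagT F (absz (n - m)%R) r).
Notation fl f i := (@flv F m n r f i).
Implicit Types (f g e : flag) (i j h u : int).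

Definition mkflag (W : int -> 'M[F]_r) : flag :=
  [ffun k : 'I_(absz (n - m)%R).+1 => genmx (W (m + (k : nat)%:Z)%R)].

Lemma flvE f (k : 'I_(absz (n - m)%R).+1) : fl f (m + (k : nat)%:Z) = f k.
Proof.
have := ltn_ord k => hk.
rewrite /flv; have -> : inrng m n (m + k%:Z) by rewrite /inrng; lia.
by congr (f _); apply: val_inj; rewrite /= inordK; lia.
Qed.

Lemma inrng_ord i : inrng m n i -> exists k : 'I_(absz (n - m)%R).+1, i = m + (k : nat)%:Z.
Proof.
move=> /inrngP[mi ni]; have hk : (absz (i - m)%R < (absz (n - m)%R).+1)%N by lia.
by exists (Ordinal hk) => /=; lia.
Qed.

Lemma flv_mkflag W i : inrng m n i -> fl (mkflag W) i = <<W i>>%MS.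
Proof. by move=> /inrng_ord[k ->]; rewrite flvE ffunE. Qed.

Lemma flv_out f i : ~~ inrng m n i -> fl f i = 0.
Proof. by rewrite /flv => /negPf->. Qed.

Lemma flv_bot f : fl f (m - 1) = 0.
Proof. by rewrite flv_out // /inrng; lia. Qed.

Lemma flv_inj f g : (forall i, inrng m n i -> fl f i = fl g i) -> f = g.
Proof.
move=> fg; apply/ffunP => k; rewrite -!flvE; apply: fg.
by have := ltn_ord k; rewrite /inrng; lia.
Qed.

Lemma flv_genmx f i : isflag f -> <<fl f i>>%MS = fl f i.
Proof.
move=> /andP[/andP[/forallP c _] _]; case hi: (inrng m n i).
  by have /inrng_ord[k ->] := hi; rewrite flvE -(eqP (c k)).
by rewrite flv_out ?hi // genmx0.
Qed.

Lemma flv_le1 f i : isflag f -> m <= i -> i < n -> (fl f i <= fl f (i + 1))%MS.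
Proof.
move=> /andP[/andP[_ /forallP c] _] mi ni.
have hk : (absz (i - m)%R < absz (n - m)%R)%N by lia.
have := c (Ordinal hk); rewrite -!flvE /= /bump /=.
have -> : m + `|(i - m)%R|%N%:Z = i by lia.
by have -> : m + (1 + `|(i - m)%R|)%N%:Z = i + 1 by lia.
Qed.

Lemma flv_top f : isflag f -> (1%:M <= fl f n)%MS.
Proof.
move=> /andP[_]; rewrite -flvE /=.
by have -> : m + `|(n - m)%R|%N%:Z = n by lia.
Qed.

Lemma flv_le f i j : isflag f -> m - 1 <= i -> i <= j -> j <= n -> (fl f i <= fl f j)%MS.
Proof.
move=> ff mi ij; move: j ij; apply: int_ind_ge => [|j ij IH] jn; first exact: submx_refl.
have [mj|mj] := lerP m j.
  by apply: submx_trans (IH _) _; [lia|apply: flv_le1 => //; lia].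
by rewrite [fl f i]flv_out ?sub0mx // /inrng; lia.
Qed.

Lemma isflag_mkflag (W : int -> 'M[F]_r) : (forall i, m <= i -> i < n -> (W i <= W (i + 1)%R)%MS) ->
  (1%:M <= W n)%MS -> isflag (mkflag W).
Proof.
move=> Wle W1; apply/andP; split; first (apply/andP; split).
- by apply/forallP => k; rewrite ffunE genmx_id.
- apply/forallP => k; rewrite !ffunE /= /bump /= !genmxE.
  have -> : m + (1 + k)%N%:Z = m + (k : nat)%:Z + 1 by lia.
  by apply: Wle; have := ltn_ord k; lia.
- rewrite ffunE /= genmxE.
  by have -> : m + `|(n - m)%R|%N%:Z = n by lia.
Qed.

Definition updflag g h W : flag := mkflag (fun i => if i == h then W else fl g i).

Definition rkcap f g i j : int := (\rank (fl f i :&: fl g j)%MS)%:Z.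

Lemma typE f g i j : isflag f -> inrng m n i -> inrng m n j ->
  typ f g i j = rkcap f g i j - rkcap f g (i - 1) j - rkcap f g i (j - 1)
                + rkcap f g (i - 1) (j - 1).
Proof.
move=> ff hi hj; rewrite /typ hi hj /=.
have H k : (\rank (fl f (i - 1) + (fl f i :&: fl g k))%MS : int)
           = (\rank (fl f (i - 1)) : int) + rkcap f g i k - rkcap f g (i - 1) k.
  have := mxrank_sum_cap (fl f (i - 1)) (fl f i :&: fl g k)%MS.
  rewrite capmxA /rkcap.
  have -> : \rank (fl f (i - 1) :&: fl f i :&: fl g k)%MS = \rank (fl f (i - 1) :&: fl g k)%MS.
    apply/eqmx_rank/eqmxP/cap_eqmx => //; apply/eqmxP.
    rewrite capmxSl sub_capmx submx_refl flv_le //; by move: hi; rewrite /inrng; lia.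
  lia.
rewrite !H; ring.
Qed.

Lemma typ_out f g i j : ~~ (inrng m n i && inrng m n j) -> typ f g i j = 0.
Proof. by rewrite /typ => /negPf->. Qed.

Lemma typ_ge0 f g i j : isflag g -> 0 <= typ f g i j.
Proof.
move=> gg; rewrite /typ; case: ifP => // /andP[hi hj].
rewrite subr_ge0 lez_nat mxrankS // addsmxS // capmxS // flv_le //; move: hj; rewrite /inrng; lia.
Qed.

Lemma rkcap_bot g f j : rkcap f g (m - 1) j = 0.
Proof. by rewrite /rkcap flv_bot cap0mx mxrank0. Qed.

Lemma rkcapC f g i j : rkcap f g i j = rkcap g f j i.
Proof. by rewrite /rkcap capmxC. Qed.

Lemma typC f g i j : isflag f -> isflag g -> typ f g i j = typ g f j i.
Proof.
move=> ff gg; case h: (inrng m n i && inrng m n j); last first.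
  by rewrite typ_out ?h // typ_out // andbC h.
case/andP: h => hi hj; rewrite !typE // ![rkcap g f _ _]rkcapC; ring.
Qed.

Lemma rkcap_top f g i : isflag g -> rkcap f g i n = (\rank (fl f i) : int).
Proof.
move=> gg; rewrite /rkcap; congr (Posz _); apply/eqmx_rank.
by rewrite capmxSl sub_capmx submx_refl (submx_trans (submx1 _)) ?flv_top.
Qed.

Lemma sum_typ_row f g i : isflag f -> isflag g -> inrng m n i ->
  \sum_(j <- rng m n) typ f g i j = (\rank (fl f i) : int) - (\rank (fl f (i - 1)) : int).
Proof.
move=> ff gg hi.
transitivity (\sum_(j <- rng m n) ((rkcap f g i j - rkcap f g (i - 1) j)
    - (rkcap f g i (j - 1) - rkcap f g (i - 1) (j - 1)))).
  apply: eq_big_seq => j; rewrite mem_rng // => hj; rewrite typE //; ring.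
rewrite (sum_rng_telescope (fun j => rkcap f g i j - rkcap f g (i - 1) j)) // !rkcap_top //.
by rewrite ![rkcap f g _ (m - 1)]rkcapC !rkcap_bot; ring.
Qed.

(** Row by row, vanishing entries off the diagonal make [rkcap] constant in its second index from
    [i] on. Hence V_i :&: V'_i has the dimension of V_i, and V_i lies in V'_i; the reverse inclusion
    follows by [typC]. *)
Lemma diag_typ_eq f g : isflag f -> isflag g ->
  (forall i j, inrng m n i -> inrng m n j -> i != j -> typ f g i j = 0) -> f = g.
Proof.
have half e e' : isflag e -> isflag e' ->
   (forall i j, inrng m n i -> inrng m n j -> i != j -> typ e e' i j = 0) ->
   forall i, m - 1 <= i -> i <= n -> (fl e i <= fl e' i)%MS.
  move=> ee ee' diag.
  have row i u : inrng m n i -> inrng m n u -> rkcap e e' i u - rkcap e e' (i - 1) u =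
      \sum_(j <- rng m n) if j < u + 1 then typ e e' i j else 0.
    move=> hi hu; rewrite -[LHS]subr0.
    have {1}-> : 0 = rkcap e e' i (m - 1) - rkcap e e' (i - 1) (m - 1).
      by rewrite ![rkcap e e' _ (m - 1)]rkcapC !rkcap_bot.
    have := @sum_rng_lt m n (u + 1) (fun j => rkcap e e' i j - rkcap e e' (i - 1) j) le_mn.
    rewrite /= addrK => <-; [|by move: hu; rewrite /inrng; lia..].
    apply: eq_big_seq => j; rewrite mem_rng // => hj; case: ifP => // _; rewrite typE //; ring.
  have key i : m - 1 <= i -> i <= n -> forall u, i <= u -> m <= u -> u <= n ->
       rkcap e e' i u = rkcap e e' i n.
    move: i; apply: int_ind_ge => [|i mi IH] hin u iu mu un; first by rewrite !rkcap_bot.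
    have hi : inrng m n (i + 1) by rewrite /inrng; lia.
    have := row (i + 1) u hi; rewrite addrK IH; [|lia..].
    have -> : inrng m n u by rewrite /inrng; lia.
    have := row (i + 1) n hi; rewrite addrK.
    have -> : inrng m n n by rewrite /inrng; lia.
    move=> /(_ isT) e1 /(_ isT) e2.
    suff : \sum_(j <- rng m n) (if j < u + 1 then typ e e' (i + 1) j else 0)
      = \sum_(j <- rng m n) (if j < n + 1 then typ e e' (i + 1) j else 0) by lia.
    apply: eq_big_seq => j; rewrite mem_rng // => hj.
    have -> : j < n + 1 by move: hj; rewrite /inrng; lia.
    case: ifP => // hju; rewrite diag //; move: hju; lia.
  move=> i mi ni; have [him|him] := lerP m i; last by rewrite flv_out ?sub0mx // /inrng; lia.
  have := key i mi ni i (lexx _) him ni; rewrite rkcap_top // /rkcap => -[] eq.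
  have [_ h] := mxrank_leqif_sup (capmxSl (fl e i) (fl e' i)).
  by move: h; rewrite eq eqxx => /esym/submx_trans; apply; apply: capmxSr.
move=> ff gg diag; apply: flv_inj => i hi; rewrite -(flv_genmx i ff) -(flv_genmx i gg).
apply/eq_genmx/eqmxP; rewrite !half //=; try by move: hi; rewrite /inrng; lia.
by move=> k l hk hl kl; rewrite typC // diag // eq_sym.
Qed.

Lemma typ_self f i j : isflag f -> inrng m n i -> inrng m n j ->
  typ f f i j = if i == j then (\rank (fl f i) : int) - (\rank (fl f (i - 1)) : int) else 0.
Proof.
move=> ff hi hj; rewrite typE //.
have C k l : m - 1 <= k -> k <= n -> m - 1 <= l -> l <= n ->
    rkcap f f k l = if k <= l then (\rank (fl f k) : int) else (\rank (fl f l) : int).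
  move=> mk kn ml ln; rewrite /rkcap; case: ifP => kl; congr (Posz _); apply/eqmx_rank.
    by rewrite capmxSl sub_capmx submx_refl flv_le.
  by rewrite capmxSr sub_capmx submx_refl andbT flv_le //; lia.
move: hi hj => /inrngP[mi ni] /inrngP[mj nj]; rewrite !C; [|lia..].
case: (ltgtP i j) => [ij|ji|<-].
- have -> : i - 1 <= j by lia. have -> : i <= j - 1 by lia.
  have -> : i - 1 <= j - 1 by lia. ring.
- have -> : i - 1 <= j = (j == i - 1) || (i - 1 < j) by lia.
  have [->|ne] /= := eqVneq j (i - 1).
    have -> : i <= i - 1 - 1 = false by lia. have -> : i - 1 <= i - 1 - 1 = false by lia. ring.
  have -> : i - 1 < j = false by lia. have -> : i <= j - 1 = false by lia.
  have -> : i - 1 <= j - 1 = false by lia. ring.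
have -> : i - 1 <= i by lia. have -> : i <= i - 1 = false by lia.
rewrite lexx; ring.
Qed.

Definition adj h f g : bool :=
  [&& [forall k : 'I_(absz (n - m)%R).+1, (m + (k : nat)%:Z != h) ==> (f k == g k)],
      (fl f h <= fl g h)%MS & (\rank (fl f h)).+1 == \rank (fl g h)].

Lemma adj_flv h f g i : adj h f g -> i != h -> fl f i = fl g i.
Proof.
move=> /and3P[/forallP a _ _] ih; case hi: (inrng m n i); last by rewrite !flv_out ?hi.
by have /inrng_ord[k e] := hi; rewrite e !flvE; move: (a k); rewrite -e ih => /eqP.
Qed.

Lemma adjP h f g : (forall i, inrng m n i -> i != h -> fl f i = fl g i) ->
  (fl f h <= fl g h)%MS -> (\rank (fl f h)).+1 = \rank (fl g h) -> adj h f g.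
Proof.
move=> a b c; rewrite /adj b c eqxx !andbT; apply/forallP => k; apply/implyP => kh.
by rewrite -!flvE a //; have := ltn_ord k; rewrite /inrng; lia.
Qed.

(* When [f] and [g] differ only at step [h], with [f_h] a hyperplane of [g_h], the positions of
   [f] and [g] relative to [e] differ only in column [u], by one unit between rows [h] and
   [h + 1]. *)
Definition jump h f g e u : bool :=
  (fl g h :&: fl e (u - 1) <= fl f h)%MS && ~~ (fl g h :&: fl e u <= fl f h)%MS.

Section Adj.
Variable h : int.
Hypotheses (le_mh : m <= h) (lt_hn : h < n).

Let hh : inrng m n h. Proof. by rewrite /inrng; lia. Qed.
Let le_m1h : m - 1 <= h. Proof. by lia. Qed.
Let le_hh1 : h <= h + 1. Proof. by lia. Qed.
Let le_h1n : h + 1 <= n. Proof. by lia. Qed.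
Let h1_neq : h + 1 != h. Proof. by lia. Qed.

(** Before [u] the steps of [e] meet g_h inside f_h, so nothing changes. From [u] on the
    intersection leaves the hyperplane f_h, its sum with f_h is all of g_h, and the dimension
    formula gives exactly one more. *)
Lemma rkcap_adj f g e u i j : adj h f g -> isflag e -> jump h f g e u -> inrng m n u ->
  m - 1 <= j -> j <= n ->
  rkcap g e i j = rkcap f e i j + (if (i == h) && (u <= j) then 1 else 0).
Proof.
move=> fg ee /andP[ju1 ju2] /inrngP[mu un] mj jn.
case: eqP => [->|/eqP ih] /=; last by rewrite /rkcap (adj_flv fg ih) addr0.
have /and3P[_ sfg /eqP rfg] := fg.
case: ifP => uj; last first.
  rewrite addr0 /rkcap; congr (Posz _); apply/eqmx_rank.
  rewrite [X in _ && X]capmxS // andbT sub_capmx capmxSr andbT.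
  by apply: submx_trans ju1; rewrite capmxS // flv_le //; lia.
have ns : ~~ (fl g h :&: fl e j <= fl f h)%MS.
  apply: contra ju2; apply: submx_trans; apply: capmxS => //; apply: flv_le => //; lia.
have := mxrank_sum_cap (fl f h) (fl g h :&: fl e j)%MS; rewrite capmxA.
have -> : \rank (fl f h :&: fl g h :&: fl e j)%MS = \rank (fl f h :&: fl e j)%MS.
  apply/eqmx_rank/eqmxP/cap_eqmx => //; apply/eqmxP.
  by rewrite capmxSl sub_capmx submx_refl.
have -> : \rank (fl f h + (fl g h :&: fl e j))%MS = \rank (fl g h).
  apply/eqP; rewrite eqn_leq mxrankS ?addsmx_sub ?sfg ?capmxSl //= -rfg.
  rewrite ltn_neqAle mxrankS ?addsmxSl // andbT.
  have [_ ->] := mxrank_leqif_sup (addsmxSl (fl f h) (fl g h :&: fl e j)%MS).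
  by apply: contra ns; apply: submx_trans; apply: addsmxSr.
rewrite /rkcap -rfg; lia.
Qed.

Lemma typ_adj f g e u i j : isflag f -> isflag g -> isflag e -> adj h f g ->
  jump h f g e u -> inrng m n u -> inrng m n i -> inrng m n j ->
  typ g e i j = typ f e i j + (if (i == h) && (j == u) then 1 else 0)
                - (if (i == h + 1) && (j == u) then 1 else 0).
Proof.
move=> ff gg ee fg ju hu hi hj; rewrite !typE //.
have [mj jn] := inrngP _ _ _ hj.
have mj1 : m - 1 <= j by rewrite (le_trans _ mj) // gerBl.
have mj2 : m - 1 <= j - 1 by rewrite lerD2r.
have j1n : j - 1 <= n by rewrite (le_trans _ jn) // gerBl.
rewrite !(rkcap_adj _ fg ee ju hu) //.
rewrite (_ : (i == h + 1) = (i - 1 == h)); last by rewrite subr_eq.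
rewrite (unit_step_diff (i == h)) (unit_step_diff (i - 1 == h)).
ring.
Qed.

Lemma jump_ex f g e : isflag g -> isflag e -> adj h f g ->
  exists2 u, inrng m n u & jump h f g e u.
Proof.
move=> gg ee /and3P[_ sfg /eqP rfg].
have : ~~ (fl g h :&: fl e n <= fl f h)%MS.
  apply/negP => /mxrankS; suff -> : \rank (fl g h :&: fl e n)%MS = \rank (fl g h) by lia.
  by apply/eqP; rewrite -eqz_nat -[X in X == _]/(rkcap g e h n) rkcap_top.
have : forall i, m - 1 <= i -> i <= n -> ~~ (fl g h :&: fl e i <= fl f h)%MS ->
   exists2 u, inrng m n u & jump h f g e u.
  apply: int_ind_ge => [|i mi IH] hin.
    by rewrite flv_bot capmx0 sub0mx.
  case hs: (fl g h :&: fl e i <= fl f h)%MS => hs1; last by apply: IH; rewrite ?hs //; lia.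
  by exists (i + 1); [rewrite /inrng; lia|rewrite /jump addrK hs].
by apply; lia.
Qed.

Lemma jump_uniq f g e u v : isflag e -> inrng m n u -> inrng m n v ->
  jump h f g e u -> jump h f g e v -> u = v.
Proof.
move=> ee.
have half u' v' : inrng m n u' -> inrng m n v' ->
    jump h f g e u' -> jump h f g e v' -> ~~ (u' < v').
  move=> /inrngP[mu un] /inrngP[mv vn] /andP[_ j1] /andP[j2 _]; apply: contra j1 => uv.
  by apply: submx_trans j2; apply: capmxS => //; apply: flv_le => //; lia.
move=> hu hv ju jv; have := half u v hu hv ju jv; have := half v u hv hu jv ju; lia.
Qed.

Lemma flv_updflag g W i : isflag g -> <<W>>%MS = W ->
  inrng m n i -> fl (updflag g h W) i = if i == h then W else fl g i.
Proof. by move=> gg WW hi; rewrite flv_mkflag //; case: eqP => // _; rewrite flv_genmx. Qed.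

Lemma isflag_updflag g W : isflag g -> (fl g (h - 1) <= W)%MS -> (W <= fl g (h + 1))%MS ->
  isflag (updflag g h W).
Proof.
move=> gg W1 W2; apply: isflag_mkflag => [i mi ni|]; last first.
  by rewrite (_ : n == h = false) ?flv_top //; lia.
case: eqP => [->|ih]; first by have -> : h + 1 == h = false by lia.
case: eqP => [ih1|_]; first by have -> : i = h - 1 by lia.
exact: flv_le1.
Qed.

(** Such an [f] is determined by its step [h], a hyperplane of g_h that must contain both g_{h-1}
    and the prescribed intersection. *)
Lemma card_hyps_flag g e j : isflag g -> isflag e ->
  #|[set f : flag | [&& isflag f, adj h f g & (fl g h :&: fl e j <= fl f h)%MS]]|
  = #|hyps_between (fl g (h - 1) + (fl g h :&: fl e j))%MS (fl g h)|.
Proof.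
move=> gg ee; rewrite -[RHS](card_in_imset (f := updflag g h)); last first.
  move=> W W'; rewrite !inE => /and4P[/eqP WW _ _ _] /and4P[/eqP WW' _ _ _].
  move=> /(congr1 (fun f => fl f h)).
  by rewrite !flv_updflag ?eqxx.
apply: eq_card => f; rewrite inE; apply/and3P/imsetP => [[ff fg sf]|[W]].
  have /and3P[_ sfg /eqP rfg] := fg.
  exists (fl f h).
    rewrite inE flv_genmx // eqxx addsmx_sub sf sfg rfg eqxx !andbT /=.
    by rewrite -(adj_flv fg) ?flv_le //; lia.
  apply: flv_inj => i hi; rewrite flv_updflag ?flv_genmx //.
  by case: eqP => [->//|/eqP ih]; apply: adj_flv fg ih.
rewrite inE addsmx_sub => /and4P[/eqP WW /andP[W1 W2] W3 /eqP W4] ->.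
have hu i : inrng m n i -> fl (updflag g h W) i = if i == h then W else fl g i.
  exact: flv_updflag.
rewrite !hu // eqxx; split => //.
  by apply: isflag_updflag => //; apply: submx_trans W3 _; apply: flv_le => //; lia.
by apply: adjP; rewrite ?hu ?eqxx // => i hi /negPf ih; rewrite hu // ih.
Qed.

(** Since f_h is a hyperplane of W = g_h, the intersection of W with e_j leaves f_h exactly when it
    spans W together with f_h. By the modular law this means that W lies in f_h + (f_{h+1} :&:
    e_j). *)
Lemma card_lines_flag f e j : isflag f -> isflag e ->
  #|[set g : flag | [&& isflag g, adj h f g & ~~ (fl g h :&: fl e j <= fl f h)%MS]]|
  = #|lines_between (fl f h) (fl f h + (fl f (h + 1) :&: fl e j))%MS|.
Proof.
move=> ff ee; rewrite -[RHS](card_in_imset (f := updflag f h)); last first.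
  move=> W W'; rewrite !inE => /and4P[/eqP WW _ _ _] /and4P[/eqP WW' _ _ _].
  move=> /(congr1 (fun f => fl f h)).
  by rewrite !flv_updflag ?eqxx.
apply: eq_card => g; rewrite inE; apply/and3P/imsetP => [[gg fg sf]|[W]].
  have /and3P[_ sfg /eqP rfg] := fg.
  exists (fl g h).
    rewrite inE flv_genmx // eqxx sfg rfg eqxx !andbT /=.
    have sub : (fl f h + (fl g h :&: fl e j) <= fl g h)%MS.
      by rewrite addsmx_sub sfg capmxSl.
    have [_ E] := mxrank_leqif_sup sub.
    have : (fl g h <= fl f h + (fl g h :&: fl e j))%MS.
      rewrite -E eqn_leq mxrankS //= -rfg ltn_neqAle mxrankS ?addsmxSl // andbT.
      have [_ ->] := mxrank_leqif_sup (addsmxSl (fl f h) (fl g h :&: fl e j)%MS).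
      by apply: contra sf; apply: submx_trans; apply: addsmxSr.
    move=> /submx_trans; apply; apply: addsmxS => //; apply: capmxS => //.
    by rewrite (adj_flv fg h1_neq); apply: flv_le.
  apply: flv_inj => i hi; rewrite flv_updflag ?flv_genmx //.
  by case: eqP => [->//|/eqP ih]; rewrite (adj_flv fg ih).
rewrite inE => /and4P[/eqP WW W1 W2 /eqP W3] ->.
have hu i : inrng m n i -> fl (updflag f h W) i = if i == h then W else fl f i.
  exact: flv_updflag.
rewrite !hu // eqxx; split => //.
- apply: isflag_updflag => //; first by apply: submx_trans W1; apply: flv_le => //; lia.
  apply: submx_trans W2 _; rewrite addsmx_sub capmxSl andbT flv_le //; lia.
- by apply: adjP; rewrite ?hu ?eqxx // => i hi /negPf ih; rewrite hu // ih.
apply/negP => sW; suff : (W <= fl f h)%MS by move=> /mxrankS; lia.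
have WE : (W <= W :&: (fl f h + (fl f (h + 1) :&: fl e j)))%MS.
  by rewrite sub_capmx submx_refl.
apply: submx_trans WE _; rewrite addsmxC -matrix_modr // addsmx_sub submx_refl andbT.
by apply: submx_trans sW; apply: capmxS => //; apply: capmxSr.
Qed.

(** The jump is at [u] when the condition of [card_hyps_flag] holds for [u - 1] and fails for [u].
    The count is thus a difference of two nested ones, and the ranks [R j] telescope into partial
    sums of row [h]. *)
Lemma card_jump_hyps g e u : isflag g -> isflag e -> inrng m n u ->
  (#|[set f : flag | [&& isflag f, adj h f g & jump h f g e u]]|%:R : rat) =
  (#|F|%:R : rat) ^ (\sum_(j <- rng m n) if u < j then typ g e h j else 0)
  * ((#|F|%:R : rat) ^ (typ g e h u) - 1) / (#|F|%:R - 1).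
Proof.
move=> gg ee hu; have /inrngP[mu un] := hu.
set S := fun j => [set f : flag | [&& isflag f, adj h f g & (fl g h :&: fl e j <= fl f h)%MS]].
have -> : [set f : flag | [&& isflag f, adj h f g & jump h f g e u]] = S (u - 1) :\: S u.
  apply/setP => f; rewrite !inE /jump.
  by case: isflag => //=; case: adj => //=; rewrite andbC.
have SS : S u \subset S (u - 1).
  apply/subsetP => f; rewrite !inE => /and3P[-> -> s] /=; apply: submx_trans s.
  by apply: capmxS => //; apply: flv_le => //; lia.
rewrite cardsD (setIidPr SS) natrB ?subset_leq_card // /S !card_hyps_flag //.
pose R j : int := (\rank (fl g (h - 1) + (fl g h :&: fl e j))%MS : int).
have sub j : (fl g (h - 1) + (fl g h :&: fl e j) <= fl g h)%MS.
  by rewrite addsmx_sub capmxSl flv_le //; lia.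
rewrite !card_hyps //.
have -> : \sum_(j <- rng m n) (if u < j then typ g e h j else 0) = R n - R u.
  rewrite -(@sum_rng_gt m n u R) //; try lia.
  by apply: eq_big_seq => j; rewrite mem_rng // /typ hh => ->.
have -> : typ g e h u = R u - R (u - 1) by rewrite /typ hh hu.
have Rn : R n = \rank (fl g h).
  rewrite /R; congr (Posz _); apply/eqmx_rank; rewrite sub /=.
  apply: submx_trans (addsmxSr _ _); rewrite sub_capmx submx_refl.
  by rewrite (submx_trans (submx1 _)) ?flv_top.
have q0 := natrF_neq0 F; have q1 := natrF_sub1_neq0 F.
have toz j : (#|F|%:R : rat) ^+ (\rank (fl g h) -
   \rank (fl g (h - 1) + (fl g h :&: fl e j))%MS) = #|F|%:R ^ (R n - R j).
  by rewrite Rn exprnP; congr (_ ^ _); rewrite -subzn // mxrankS.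
rewrite !toz mulrBr mulr1 -expfzDr; last by [].
have -> : R n - R u + (R u - R (u - 1)) = R n - R (u - 1) by ring.
by rewrite -mulrBl opprB addrA subrK.
Qed.

(** Mirror image of [card_jump_hyps]: the condition of [card_lines_flag] gets weaker as [j] grows,
    so row [h + 1] is summed from the left. *)
Lemma card_jump_lines f e u : isflag f -> isflag e -> inrng m n u ->
  (#|[set g : flag | [&& isflag g, adj h f g & jump h f g e u]]|%:R : rat) =
  (#|F|%:R : rat) ^ (\sum_(j <- rng m n) if j < u then typ f e (h + 1) j else 0)
  * ((#|F|%:R : rat) ^ (typ f e (h + 1) u) - 1) / (#|F|%:R - 1).
Proof.
move=> ff ee hu; have /inrngP[mu un] := hu.
have hh1 : inrng m n (h + 1) by rewrite /inrng; lia.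
set S := fun j => [set g : flag | [&& isflag g, adj h f g & ~~ (fl g h :&: fl e j <= fl f h)%MS]].
have -> : [set g : flag | [&& isflag g, adj h f g & jump h f g e u]] = S u :\: S (u - 1).
  apply/setP => g; rewrite !inE /jump.
  by case: isflag => //=; case: adj => //=; rewrite negbK.
have SS : S (u - 1) \subset S u.
  apply/subsetP => g; rewrite !inE => /and3P[-> -> s] /=; apply: contra s; apply: submx_trans.
  by apply: capmxS => //; apply: flv_le => //; lia.
rewrite cardsD (setIidPr SS) natrB ?subset_leq_card // /S !card_lines_flag //.
pose R j : int := (\rank (fl f h + (fl f (h + 1) :&: fl e j))%MS : int).
rewrite !card_lines ?addsmxSl //.
have -> : \sum_(j <- rng m n) (if j < u then typ f e (h + 1) j else 0) = R (u - 1) - R (m - 1).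
  rewrite -(@sum_rng_lt m n u R) //; try lia.
  by apply: eq_big_seq => j; rewrite mem_rng // /typ hh1 addrK => ->.
have -> : typ f e (h + 1) u = R u - R (u - 1) by rewrite /typ hh1 hu addrK.
have Rm : R (m - 1) = \rank (fl f h).
  by rewrite /R flv_bot capmx0 addsmx0.
have q0 := natrF_neq0 F; have q1 := natrF_sub1_neq0 F.
have toz j : (#|F|%:R : rat) ^+ (\rank (fl f h + (fl f (h + 1) :&: fl e j))%MS
   - \rank (fl f h)) = #|F|%:R ^ (R j - R (m - 1)).
  by rewrite Rm exprnP; congr (_ ^ _); rewrite -subzn // mxrankS ?addsmxSl.
rewrite !toz mulrBr mulr1 -expfzDr; last by [].
have -> : R (u - 1) - R (m - 1) + (R u - R (u - 1)) = R u - R (m - 1) by ring.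
by rewrite -mulrBl opprB addrA subrK.
Qed.

End Adj.
End Flags.

(** * Coefficients depending on q and a *)

Definition qeval (q : nat) (c : {poly int}) : rat := (c.[q%:Z])%:~R.

Lemma qeval_is_zmod_morphism q : zmod_morphism (qeval q).
Proof. by move=> c d; rewrite /qeval hornerD hornerN rmorphB. Qed.
Lemma qeval_is_monoid_morphism q : monoid_morphism (qeval q).
Proof. by split=> [|c d]; rewrite /qeval ?hornerC // hornerM rmorphM. Qed.
HB.instance Definition _ q :=
  GRing.isZmodMorphism.Build {poly int} rat (qeval q) (qeval_is_zmod_morphism q).
HB.instance Definition _ q :=
  GRing.isMonoidMorphism.Build {poly int} rat (qeval q) (qeval_is_monoid_morphism q).

Lemma qevalX q : qeval q 'X = q%:R.
Proof. by rewrite /qeval hornerX. Qed.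

Definition good_den (D : {poly int}) :=
  D \is monic /\ forall q : nat, (1 < q)%N -> qeval q D != 0.

(* [phi q a] is a polynomial of degree at most [k] in [q^a], with coefficients in [Z[q]]
   localized at monic polynomials; monicity of the denominator is what makes the Hall numbers
   polynomials with integer coefficients. *)
Definition good (k : nat) (phi : nat -> int -> rat) :=
  exists (D : {poly int}) (P : {poly {poly int}}),
    [/\ good_den D, (size P <= k.+1)%N &
      forall (q : nat) (a : int), (1 < q)%N ->
        phi q a = (map_poly (qeval q) P).[(q%:R : rat) ^ a] / qeval q D].

Lemma good_denM D D' : good_den D -> good_den D' -> good_den (D * D').
Proof.
move=> [mD nD] [mD' nD']; split; first by rewrite monicMl.
by move=> q q1; rewrite rmorphM mulf_neq0 ?nD ?nD'.
Qed.

Lemma good_den1 : good_den 1.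
Proof. by split=> [|q _]; rewrite ?monic1 ?rmorph1. Qed.

Lemma good_ext k phi psi : good k phi ->
  (forall q a, (1 < q)%N -> phi q a = psi q a) -> good k psi.
Proof. by move=> [D [P [gD sP e]]] h; exists D, P; split=> // q a q1; rewrite -h ?e. Qed.

Lemma good_le k k' phi : (k <= k')%N -> good k phi -> good k' phi.
Proof.
by move=> kk [D [P [gD sP e]]]; exists D, P; split=> //; apply: leq_trans sP _; rewrite ltnS.
Qed.

Lemma good_add k phi psi : good k phi -> good k psi -> good k (fun q a => phi q a + psi q a).
Proof.
move=> [D [P [gD sP e]]] [D' [P' [gD' sP' e']]]; exists (D * D'), (D' *: P + D *: P'); split.
- exact: good_denM.
- by rewrite (leq_trans (size_polyD _ _)) // geq_max !(leq_trans (size_scale_leq _ _)).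
move=> q a q1; rewrite e // e' //.
have := gD.2 q q1; have := gD'.2 q q1.
rewrite !rmorphD !rmorphM /= !map_polyZ hornerD !hornerZ => d d'; field; exact/andP.
Qed.

Lemma good_mul k l phi psi : good k phi -> good l psi ->
  good (k + l) (fun q a => phi q a * psi q a).
Proof.
move=> [D [P [gD sP e]]] [D' [P' [gD' sP' e']]]; exists (D * D'), (P * P'); split.
- exact: good_denM.
- have := size_polyMleq P P'; lia.
move=> q a q1; rewrite e // e' //.
by rewrite !rmorphM /= hornerM invfM mulrACA.
Qed.

Lemma good_const (c : int) : good 0 (fun _ _ => c%:~R).
Proof.
exists 1, (c%:P)%:P; split; [exact: good_den1|exact: size_polyC_leq1|move=> q a _].
by rewrite map_polyC hornerC rmorph1 divr1 /= /qeval hornerC.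
Qed.

Lemma good_den_Xn k : good_den 'X^k.
Proof.
split; first exact: monicXn.
by move=> q q1; rewrite rmorphXn /= qevalX expf_neq0 // pnatr_eq0; case: q q1.
Qed.

Lemma good_den_Xn_sub1 k : (0 < k)%N -> good_den ('X^k - 1).
Proof.
move=> k0; split; first by rewrite monicXnsubC.
move=> q q1; rewrite rmorphB rmorphXn rmorph1 /= qevalX subr_eq0 -natrX.
by rewrite (eqr_nat rat _ 1) -(expn0 q) eqn_exp2l // -lt0n.
Qed.

Lemma good_exp (z : int) : good 0 (fun q _ => (q%:R : rat) ^ z).
Proof.
case: z => k.
  exists 1, ('X^k)%:P; split; [exact: good_den1|exact: size_polyC_leq1|move=> q a _].
  by rewrite map_polyC hornerC rmorph1 divr1 /= rmorphXn /= qevalX.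
exists 'X^(k.+1), 1; split; [exact: good_den_Xn|by rewrite size_poly1|move=> q a _].
by rewrite rmorph1 hornerC rmorphXn /= qevalX mul1r.
Qed.

Lemma good_exp_a : good 1 (fun q a => (q%:R : rat) ^ a).
Proof.
exists 1, 'X; split; [exact: good_den1|by rewrite size_polyX|move=> q a _].
by rewrite map_polyX hornerX rmorph1 divr1.
Qed.

Lemma good_exp_aff (z : int) (b : bool) :
  good b (fun q a => (q%:R : rat) ^ (z + (if b then a else 0))).
Proof.
case: b; last by apply: good_ext (good_exp z) _ => q a _; rewrite addr0.
apply: good_ext (good_mul (good_exp z) good_exp_a) _ => q a q1.
by rewrite expfzDr // pnatr_eq0; case: q q1.
Qed.

Lemma good_inv_Xn_sub1 k : (0 < k)%N -> good 0 (fun q _ => ((q%:R : rat) ^+ k - 1)^-1).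
Proof.
move=> k0; exists ('X^k - 1), 1; split; [exact: good_den_Xn_sub1|by rewrite size_poly1|].
by move=> q a _; rewrite rmorph1 hornerC rmorphB rmorphXn rmorph1 /= qevalX mul1r.
Qed.

(** A power of q times a q-integer, the form of the counts in [card_jump_hyps] and
    [card_jump_lines]. The booleans record which of the two exponents contains a diagonal entry,
    hence [a]. *)
Definition stepcoef (z c : int) (b b' : bool) (q : nat) (a : int) : rat :=
  (q%:R : rat) ^ (z + (if b then a else 0))
  * ((q%:R : rat) ^ (c + (if b' then a else 0)) - 1) / (q%:R - 1).

Lemma good_stepcoef (z c : int) (b b' : bool) : good (b + b') (stepcoef z c b b').
Proof.
rewrite -[(b + b')%N]addn0 /stepcoef.
have i1 : good 0 (fun q _ => ((q%:R : rat) - 1)^-1).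
  exact: (good_inv_Xn_sub1 (k := 1)).
refine (good_mul (good_mul (good_exp_aff z b) _) i1).
apply: (@good_add b' _ (fun _ _ => -1)); first exact: good_exp_aff.
exact: good_le (good_const (-1)).
Qed.

(* For [c > 0] the coefficient of the leading term is invertible, and it is free of [a]. *)
Lemma good_stepcoef_inv z c : 0 < c -> good 0 (fun q a => (stepcoef z c false false q a)^-1).
Proof.
move=> c0; have c1 : (0 < absz c)%N by lia.
have num : good 0 (fun q _ => (q%:R : rat) - 1).
  apply: (@good_add 0 (fun q _ => q%:R) (fun _ _ => -1)).
    by apply: good_ext (good_exp 1) _.
  exact: (good_const (-1)).
apply: good_ext (good_mul (good_exp (- z)) (good_mul num (good_inv_Xn_sub1 c1))) _.
move=> q a q1; rewrite /stepcoef !addr0 !invfM invrK exprnP.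
have -> : absz c = c :> int by lia.
by rewrite -invr_expz; ring.
Qed.

Lemma stepcoef_neq0 z c q a : 0 < c -> (1 < q)%N -> stepcoef z c false false q a != 0.
Proof.
move=> c0 q1; have c1 : (0 < absz c)%N by lia.
have := (good_den_Xn_sub1 c1).2 q q1; have := (good_den_Xn_sub1 (ltn0Sn 0)).2 q q1.
rewrite !rmorphB !rmorphXn !rmorph1 /= !qevalX expr1 exprnP.
have -> : absz c = c :> int by lia.
move=> n1 nc; rewrite /stepcoef !addr0 mulf_neq0 ?invr_neq0 // mulf_neq0 //.
by rewrite expfz_neq0 // pnatr_eq0; case: q q1 {n1 nc}.
Qed.

(** * Stable families of kernels on pairs of flags *)

Section Families.
Implicit Types m n i j h u : int.

(* Functions on pairs of flags, uniformly in the field, in [a], in [m, n] and in the dimension.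
   [famM X] is the basis element [e_X] for the matrix [_a(X^[m,n])], [famC] is convolution, and
   [famE h], [famF h] are convolution on the left by the relation [adj h] and its converse. *)
Definition pairfam := forall (F : finFieldType) (a m n : int) (r : nat),
  flagT F (absz (n - m)%R) r -> flagT F (absz (n - m)%R) r -> rat.

Definition famM (X : mxZ) : pairfam := fun F a m n r f1 f2 =>
  (eqZmx m n (typ f1 f2) (ext a m n X))%:R.

Definition famE h (T : pairfam) : pairfam := fun F a m n r f1 f2 =>
  \sum_(f | isflag f && adj h f f1) T F a m n r f f2.

Definition famF h (T : pairfam) : pairfam := fun F a m n r f1 f2 =>
  \sum_(f | isflag f && adj h f1 f) T F a m n r f f2.

Definition famC (T T' : pairfam) : pairfam := fun F a m n r f1 f2 =>
  \sum_(f | isflag f) T F a m n r f1 f * T' F a m n r f f2.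

Definition shift (e : int) h u (X : mxZ) : mxZ := fun i j =>
  X i j + (if (i == h) && (j == u) then e else 0) - (if (i == h + 1) && (j == u) then e else 0).

Lemma eqZmxP m n (A B : mxZ) : m <= n ->
  reflect (forall i j, inrng m n i -> inrng m n j -> A i j = B i j) (eqZmx m n A B).
Proof.
move=> mn; apply: (iffP allP) => [h i j hi hj|h i].
  by have := h i; rewrite mem_rng // => /(_ hi)/allP/(_ j); rewrite mem_rng // => /(_ hj)/eqP.
by rewrite mem_rng // => hi; apply/allP => j; rewrite mem_rng // => hj; apply/eqP/h.
Qed.

Lemma shiftK e h u X i j : shift (- e) h u (shift e h u X) i j = X i j.
Proof. by rewrite /shift; do 2!case: ifP => _; lia. Qed.

Lemma ext_shift a m n e h u X i j : ext a m n (shift e h u X) i j = shift e h u (ext a m n X) i j.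
Proof. by rewrite /shift /ext; lia. Qed.

End Families.

(** * Elementary moves applied to basis elements *)

Section Stab.
Variables m0 n0 : int.
Hypothesis le_mn0 : m0 <= n0.
Implicit Types m n i j h u : int.

Lemma inXiT_out X i j : inXiT m0 n0 X -> ~~ (inrng m0 n0 i && inrng m0 n0 j) -> X i j = 0.
Proof. by case=> + _; apply. Qed.

Definition eqfam (T T' : pairfam) := forall F a m n r
  (f1 f2 : flagT F (absz (n - m)%R) r), m <= m0 -> n0 <= n -> isflag f1 -> isflag f2 ->
  T F a m n r f1 f2 = T' F a m n r f1 f2.

(** The entries are those of the shifted matrix, whence the [+ 1]. The [a] of row [h] sits in column
    [h]: beyond [u] when [u < h], at [u] when [u == h]. *)
Definition lower_coef h u (X : mxZ) : nat -> int -> rat :=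
  stepcoef (\sum_(j <- rng m0 n0) if u < j then X h j else 0) (X h u + 1) (u < h) (u == h).
Definition raise_coef h u (X : mxZ) : nat -> int -> rat :=
  stepcoef (\sum_(j <- rng m0 n0) if j < u then X (h + 1) j else 0) (X (h + 1) u + 1)
    (h + 1 < u) (u == h + 1).

Lemma sum_ext_row a m n i (P : pred int) X : inXiT m0 n0 X -> inrng m0 n0 i ->
  m <= m0 -> n0 <= n ->
  \sum_(j <- rng m n) (if P j then ext a m n X i j else 0)
  = \sum_(j <- rng m0 n0) (if P j then X i j else 0) + (if P i then a else 0).
Proof.
move=> XX hi mm nn; have mn : m <= n by lia.
have hi' : inrng m n i by move: hi; rewrite /inrng; lia.
transitivity (\sum_(j <- rng m n) ((if P j then X i j else 0)
   + (if j == i then (if P i then a else 0) else 0))).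
  apply: eq_bigr => j _; rewrite /ext hi' andbT.
  by rewrite eq_sym; case: eqP => [->|_]; case: ifP => _; rewrite ?addr0.
rewrite big_split /= sum_rng1 // hi'; congr (_ + _).
apply: sum_rng_sub => // j hj; case: ifP => // _.
by rewrite (inXiT_out XX) // negb_and hj orbT.
Qed.

Section Step.
Variables (h : int).
Hypotheses (le_mh : m0 <= h) (lt_hn : h < n0).

(** Each [f] just below [f1] has exactly one jump column [u], and then [f] has position [X] relative
    to [f2] exactly when [f1] has the position shifted in column [u]; [card_jump_hyps] counts these
    [f]. Column [h + 1] is always kept because its entry in row [h + 1] is diagonal and receives
    [a]. *)
Lemma famE_M X : inXiT m0 n0 X ->
  eqfam (famE h (famM X)) (fun F a m n r f1 f2 =>
    \sum_(u <- rng m0 n0 | (u == h + 1) || (0 < X (h + 1) u))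
      lower_coef h u X #|F| a * famM (shift 1 h u X) a f1 f2).
Proof.
move=> XX F a m n r f1 f2 mm nn ff1 ff2; have mn : m <= n by lia.
have mh : m <= h by lia.
have hn : h < n by lia.
have hh : inrng m n h by rewrite /inrng; lia.
have hh1 : inrng m n (h + 1) by rewrite /inrng; lia.
have tj f u : isflag f -> adj h f f1 -> inrng m n u -> jump h f f1 f2 u ->
   eqZmx m n (typ f f2) (ext a m n X) = eqZmx m n (typ f1 f2) (ext a m n (shift 1 h u X)).
  move=> ff fg hu ju; apply/eqZmxP/eqZmxP => // e i j hi hj.
    by rewrite (typ_adj mn mh hn ff ff1 ff2 fg ju) // ext_shift /shift e.
  by have := e i j hi hj; rewrite (typ_adj mn mh hn ff ff1 ff2 fg ju) // ext_shift => /addIr/addIr.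
transitivity (\sum_(u <- rng m n)
    (#|[set f | [&& isflag f, adj h f f1 & jump h f f1 f2 u]]|%:R : rat)
    * famM (shift 1 h u X) a f1 f2).
  rewrite /famE.
  transitivity (\sum_(f | isflag f && adj h f f1) \sum_(u <- rng m n)
      (jump h f f1 f2 u)%:R * famM (shift 1 h u X) a f1 f2).
    apply: eq_bigr => f /andP[ff fg].
    have [u hu ju] := jump_ex mn mh hn ff1 ff2 fg.
    rewrite (bigD1_seq u) ?rng_uniq ?mem_rng //= ju mul1r big1_seq ?addr0 => [|v].
      by rewrite /famM (tj f u).
    rewrite mem_rng // => /andP[vu hv]; case jv: (jump h f f1 f2 v); last by rewrite mul0r.
    by rewrite (jump_uniq mn mh hn ff2 hu hv ju jv) eqxx in vu.
  rewrite exchange_big /=; apply: eq_bigr => u _; rewrite -mulr_suml; congr (_ * _).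
  rewrite -natr_sum -sum1_card; congr (_%:R).
  rewrite big_mkcond /= [RHS]big_mkcond /=; apply: eq_bigr => f _.
  by rewrite inE; case: isflag => //=; case: adj.
rewrite (bigID (fun u => inrng m0 n0 u && ((u == h + 1) || (0 < X (h + 1) u)))) /=.
(* In a discarded column the entry of row [h + 1] would become -1, whereas [typ] is nonnegative. *)
rewrite [X in _ + X]big1_seq ?addr0 => [|u]; last first.
  rewrite mem_rng // => /andP[hc hu].
  suff : ~~ eqZmx m n (typ f1 f2) (ext a m n (shift 1 h u X)).
    by rewrite /famM => /negPf->; rewrite mulr0.
  apply/negP => /eqZmxP-/(_ mn (h + 1) u hh1 hu) e.
  have := typ_ge0 mn f1 (h + 1) u ff2; rewrite e ext_shift /shift /ext.
  rewrite !eqxx (_ : h + 1 == h = false) /=; last by lia.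
  have := XX.2 (h + 1) u; have := @inXiT_out X (h + 1) u XX.
  by move: hc; case: (h + 1 =P u) => [<-|hu1]; rewrite /inrng ?eqxx /=; lia.
rewrite -big_filter -[RHS]big_filter.
have -> : [seq u <- rng m n | inrng m0 n0 u && ((u == h + 1) || (0 < X (h + 1) u))]
  = [seq u <- [seq u <- rng m n | inrng m0 n0 u] | (u == h + 1) || (0 < X (h + 1) u)].
  by rewrite -filter_predI; apply: eq_filter => u /=; rewrite andbC.
rewrite (perm_big [seq u <- rng m0 n0 | (u == h + 1) || (0 < X (h + 1) u)]); last first.
  by apply/perm_filter/perm_rng_filter => // i; rewrite /inrng; lia.
apply: eq_big_seq => u; rewrite mem_filter mem_rng // => /andP[_ hu].
have hu' : inrng m n u by move: hu; rewrite /inrng; lia.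
rewrite card_jump_hyps // /famM; case: eqZmxP => // [e|_]; last by rewrite !mulr0.
rewrite /lower_coef /stepcoef; congr (_ ^ _ * (_ ^ _ - _) / _ * _).
  rewrite -(@sum_ext_row a m n h (fun j => u < j)) //; last by rewrite /inrng; lia.
  apply: eq_big_seq => j; rewrite mem_rng // => hj; case: ifP => // uj.
  by rewrite e // ext_shift /shift (_ : j == u = false) ?andbF ?addr0 ?subr0 //; lia.
rewrite e // ext_shift /shift /ext hh !eqxx (_ : h == h + 1 = false) /=; last by lia.
by rewrite andbT eq_sym; ring.
Qed.

Lemma famF_M X : inXiT m0 n0 X ->
  eqfam (famF h (famM X)) (fun F a m n r f1 f2 =>
    \sum_(u <- rng m0 n0 | (u == h) || (0 < X h u))
      raise_coef h u X #|F| a * famM (shift (-1) h u X) a f1 f2).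
Proof.
move=> XX F a m n r f1 f2 mm nn ff1 ff2; have mn : m <= n by lia.
have mh : m <= h by lia.
have hn : h < n by lia.
have hh : inrng m n h by rewrite /inrng; lia.
have hh1 : inrng m n (h + 1) by rewrite /inrng; lia.
have opp (c : bool) : (if c then -1 else 0) = - (if c then 1 else 0) :> int by case: c.
have tj f u : isflag f -> adj h f1 f -> inrng m n u -> jump h f1 f f2 u ->
   eqZmx m n (typ f f2) (ext a m n X) = eqZmx m n (typ f1 f2) (ext a m n (shift (-1) h u X)).
  move=> ff fg hu ju; apply/eqZmxP/eqZmxP => // e i j hi hj.
    have := e i j hi hj; rewrite (typ_adj mn mh hn ff1 ff ff2 fg ju) // ext_shift /shift !opp.
    by move=> <-; ring.
  by rewrite (typ_adj mn mh hn ff1 ff ff2 fg ju) // e // ext_shift /shift !opp; ring.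
transitivity (\sum_(u <- rng m n)
    (#|[set f | [&& isflag f, adj h f1 f & jump h f1 f f2 u]]|%:R : rat)
    * famM (shift (-1) h u X) a f1 f2).
  rewrite /famF.
  transitivity (\sum_(f | isflag f && adj h f1 f) \sum_(u <- rng m n)
      (jump h f1 f f2 u)%:R * famM (shift (-1) h u X) a f1 f2).
    apply: eq_bigr => f /andP[ff fg].
    have [u hu ju] := jump_ex mn mh hn ff ff2 fg.
    rewrite (bigD1_seq u) ?rng_uniq ?mem_rng //= ju mul1r big1_seq ?addr0 => [|v].
      by rewrite /famM (tj f u).
    rewrite mem_rng // => /andP[vu hv]; case jv: (jump h f1 f f2 v); last by rewrite mul0r.
    by rewrite (jump_uniq mn mh hn ff2 hu hv ju jv) eqxx in vu.
  rewrite exchange_big /=; apply: eq_bigr => u _; rewrite -mulr_suml; congr (_ * _).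
  rewrite -natr_sum -sum1_card; congr (_%:R).
  rewrite big_mkcond /= [RHS]big_mkcond /=; apply: eq_bigr => f _.
  by rewrite inE; case: isflag => //=; case: adj.
rewrite (bigID (fun u => inrng m0 n0 u && ((u == h) || (0 < X h u)))) /=.
rewrite [X in _ + X]big1_seq ?addr0 => [|u]; last first.
  rewrite mem_rng // => /andP[hc hu].
  suff : ~~ eqZmx m n (typ f1 f2) (ext a m n (shift (-1) h u X)).
    by rewrite /famM => /negPf->; rewrite mulr0.
  apply/negP => /eqZmxP-/(_ mn h u hh hu) e.
  have := typ_ge0 mn f1 h u ff2; rewrite e ext_shift /shift /ext.
  rewrite !eqxx (_ : h == h + 1 = false) /=; last by lia.
  have := XX.2 h u; have := @inXiT_out X h u XX.
  by move: hc; case: (h =P u) => [<-|hu1]; rewrite /inrng ?eqxx /=; lia.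
rewrite -big_filter -[RHS]big_filter.
have -> : [seq u <- rng m n | inrng m0 n0 u && ((u == h) || (0 < X h u))]
  = [seq u <- [seq u <- rng m n | inrng m0 n0 u] | (u == h) || (0 < X h u)].
  by rewrite -filter_predI; apply: eq_filter => u /=; rewrite andbC.
rewrite (perm_big [seq u <- rng m0 n0 | (u == h) || (0 < X h u)]); last first.
  by apply/perm_filter/perm_rng_filter => // i; rewrite /inrng; lia.
apply: eq_big_seq => u; rewrite mem_filter mem_rng // => /andP[_ hu].
have hu' : inrng m n u by move: hu; rewrite /inrng; lia.
rewrite card_jump_lines // /famM; case: eqZmxP => // [e|_]; last by rewrite !mulr0.
rewrite /raise_coef /stepcoef; congr (_ ^ _ * (_ ^ _ - _) / _ * _).
  rewrite -(@sum_ext_row a m n (h + 1) (fun j => j < u)) //; last by rewrite /inrng; lia.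
  apply: eq_big_seq => j; rewrite mem_rng // => hj; case: ifP => // uj.
  by rewrite e // ext_shift /shift (_ : j == u = false) ?andbF ?addr0 ?subr0 //; lia.
rewrite e // ext_shift /shift /ext hh1 !eqxx (_ : h + 1 == h = false) /=; last by lia.
by rewrite andbT eq_sym; ring.
Qed.

End Step.
End Stab.

(** * Stable families and their weight *)

Section Stable.
Variables m0 n0 : int.
Hypothesis le_mn0 : m0 <= n0.
Implicit Types m n i j h u : int.

Definition wt (w : int -> int -> int) (X : mxZ) : int :=
  \sum_(i <- rng m0 n0) \sum_(j <- rng m0 n0) w i j * X i j.

(* [len X] is the coefficient of [a] in [dmx m n (ext a m n X)]; the measure [sqlen] has convex
   weights, so that in [famE_M] and [famF_M] it is largest at the extreme column [u]. *)
Definition len (X : mxZ) : int := wt (fun i j => `|i - j|) X.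
Definition sqlen (X : mxZ) : int := wt (fun i j => (i - j) ^+ 2) X.

Lemma wt_delta w h u : inrng m0 n0 h -> inrng m0 n0 u -> forall e : int,
  \sum_(i <- rng m0 n0) \sum_(j <- rng m0 n0) w i j * (if (i == h) && (j == u) then e else 0)
  = w h u * e.
Proof.
move=> hh hu e.
transitivity (\sum_(i <- rng m0 n0) if i == h then w h u * e else 0); last first.
  by rewrite sum_rng1 // hh.
apply: eq_bigr => i _; case: eqP => [->|_] /=; last by rewrite big1 // => j _; rewrite mulr0.
transitivity (\sum_(j <- rng m0 n0) if j == u then w h u * e else 0); last first.
  by rewrite sum_rng1 // hu.
by apply: eq_bigr => j _; case: eqP => [->|_] //; rewrite mulr0.
Qed.

Lemma wt_shift w e h u X : inrng m0 n0 h -> inrng m0 n0 (h + 1) -> inrng m0 n0 u ->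
  wt w (shift e h u X) = wt w X + e * (w h u - w (h + 1) u).
Proof.
move=> hh hh1 hu.
transitivity (wt w X
  + (\sum_(i <- rng m0 n0) \sum_(j <- rng m0 n0) w i j * (if (i == h) && (j == u) then e else 0))
  - (\sum_(i <- rng m0 n0) \sum_(j <- rng m0 n0)
       w i j * (if (i == h + 1) && (j == u) then e else 0))).
  rewrite /wt -big_split -sumrB; apply: eq_bigr => i _.
  by rewrite -big_split -sumrB; apply: eq_bigr => j _; rewrite /shift /= mulrBr mulrDr.
by rewrite !wt_delta //; ring.
Qed.

Lemma wt1 X : wt (fun _ _ => 1) X = sigmaZ m0 n0 X.
Proof. by apply: eq_bigr => i _; apply: eq_bigr => j _; rewrite mul1r. Qed.

Lemma inXiT_shiftE h u X : m0 <= h -> h < n0 -> inrng m0 n0 u -> inXiT m0 n0 X ->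
  (u == h + 1) || (0 < X (h + 1) u) -> inXiT m0 n0 (shift 1 h u X).
Proof.
move=> mh hn hu [X0 Xp] hc; split=> i j ij; rewrite /shift.
  rewrite X0 //; move: ij hu; rewrite /inrng.
  by case: eqP => [->|_]; case: eqP => [->|_]; case: eqP => [?|_] /=; lia.
have := Xp i j ij.
by case: (i =P h) => e1; case: (j =P u) => e2; case: (i =P h + 1) => e3; rewrite /=; subst; lia.
Qed.

Lemma inXiT_shiftF h u X : m0 <= h -> h < n0 -> inrng m0 n0 u -> inXiT m0 n0 X ->
  (u == h) || (0 < X h u) -> inXiT m0 n0 (shift (-1) h u X).
Proof.
move=> mh hn hu [X0 Xp] hc; split=> i j ij; rewrite /shift.
  rewrite X0 //; move: ij hu; rewrite /inrng.
  by case: eqP => [->|_]; case: eqP => [->|_]; case: eqP => [?|_] /=; lia.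
have := Xp i j ij.
by case: (i =P h) => e1; case: (j =P u) => e2; case: (i =P h + 1) => e3; rewrite /=; subst; lia.
Qed.

(* The degree [k] of the coefficient of [X] satisfies [2 k = w - len X], so that normalizing by
   powers of [v] leaves only nonnegative powers of [v' = v^-a]. *)
Inductive stable (s : int) : int -> pairfam -> Prop :=
| stable_zero w : stable s w (fun F a m n r f1 f2 => 0)
| stable_term w X k phi : inXiT m0 n0 X -> sigmaZ m0 n0 X = s -> w = len X + 2 * (k : nat)%:Z ->
    good k phi -> stable s w (fun F a m n r f1 f2 => phi #|F| a * famM X a f1 f2)
| stable_add w T1 T2 : stable s w T1 -> stable s w T2 ->
    stable s w (fun F a m n r f1 f2 => T1 F a m n r f1 f2 + T2 F a m n r f1 f2)
| stable_eq w T T' : eqfam m0 n0 T T' -> stable s w T' -> stable s w T.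

Lemma stable_scale s w T k psi : good k psi -> stable s w T ->
  stable s (w + 2 * (k : nat)%:Z) (fun F a m n r f1 f2 => psi #|F| a * T F a m n r f1 f2).
Proof.
move=> gpsi; elim=> {w T} [w|w X l phi XX sX -> gphi|w T1 T2 _ IH1 _ IH2|w T T' eT _ IH].
- apply: stable_eq (stable_zero _ _) => F a m n r f1 f2 *; exact: mulr0.
- apply: stable_eq (stable_term XX sX _ (good_mul gpsi gphi)); last by lia.
  by move=> F a m n r f1 f2 *; rewrite mulrA.
- apply: stable_eq (stable_add IH1 IH2).
  by move=> F a m n r f1 f2 *; rewrite mulrDr.
- by apply: stable_eq IH => F a m n r f1 f2 *; rewrite eT.
Qed.

Lemma stable_sum s w (S : seq int) (P : pred int) (T : int -> pairfam) :
  (forall u, u \in S -> P u -> stable s w (T u)) ->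
  stable s w (fun F a m n r f1 f2 => \sum_(u <- S | P u) T u F a m n r f1 f2).
Proof.
elim: S => [|v S IH] ST.
  by apply: stable_eq (stable_zero _ _) => F a m n r f1 f2 *; rewrite big_nil.
have IH' := IH (fun u uS => ST u (mem_behead (s := v :: S) uS)).
case Pv: (P v).
  apply: stable_eq (stable_add (ST v (mem_head _ _) Pv) IH').
  by move=> F a m n r f1 f2 *; rewrite big_cons Pv.
by apply: stable_eq IH' => F a m n r f1 f2 *; rewrite big_cons Pv.
Qed.

Lemma stable_sub s w T1 T2 : stable s w T1 -> stable s w T2 ->
  stable s w (fun F a m n r f1 f2 => T1 F a m n r f1 f2 - T2 F a m n r f1 f2).
Proof.
move=> s1 s2; have := stable_scale (good_const (-1)) s2; rewrite addr0 => s2'.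
by apply: stable_eq (stable_add s1 s2') => F a m n r f1 f2 *; rewrite mulN1r.
Qed.

Lemma natr_q1 (F : finFieldType) : (1 < #|F|)%N.
Proof. exact: card_finNzRing_gt1. Qed.

Section Step.
Variable h : int.
Hypotheses (le_mh : m0 <= h) (lt_hn : h < n0).

Let hh : inrng m0 n0 h. Proof. by rewrite /inrng; lia. Qed.
Let hh1 : inrng m0 n0 (h + 1). Proof. by rewrite /inrng; lia. Qed.

(** A unit moved from row [h + 1] to row [h] in column [u] changes [len] by 1 if [u > h] and by -1
    if [u <= h]. The coefficient has degree 1 in q^a precisely in the second case, so the weight
    grows by one in both. *)
Lemma stable_famE s w T : stable s w T -> stable s (w + 1) (famE h T).
Proof.
elim=> {w T} [w|w X l phi XX sX -> gphi|w T1 T2 _ IH1 _ IH2|w T T' eT _ IH].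
- apply: stable_eq (stable_zero _ _) => F a m n r f1 f2 *; exact: big1.
- refine (@stable_eq _ _ _ (fun F a m n r f1 f2 =>
    \sum_(u <- rng m0 n0 | (u == h + 1) || (0 < X (h + 1) u))
      (phi #|F| a * lower_coef m0 n0 h u X #|F| a) * famM (shift 1 h u X) a f1 f2) _ _).
    move=> F a m n r f1 f2 mm nn ff1 ff2.
    rewrite /famE -mulr_sumr; have := famE_M le_mn0 le_mh lt_hn XX a mm nn ff1 ff2.
    by rewrite /famE => ->; rewrite mulr_sumr; apply: eq_bigr => u _; rewrite mulrA.
  apply: (@stable_sum _ _ _ _ (fun u F a m n r f1 f2 =>
    (phi #|F| a * lower_coef m0 n0 h u X #|F| a) * famM (shift 1 h u X) a f1 f2)) => u.
  rewrite mem_rng // => hu hc.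
  apply: (@stable_term _ _ _ _ (fun q a => phi q a * lower_coef m0 n0 h u X q a))
    (good_mul gphi (good_stepcoef _ _ _ _)).
  + exact: inXiT_shiftE.
  + by rewrite -wt1 wt_shift // wt1 sX; ring.
  + rewrite /len wt_shift //; case: ltgtP => ? /=; lia.
- apply: stable_eq (stable_add IH1 IH2).
  by move=> F a m n r f1 f2 *; rewrite /famE big_split.
- apply: stable_eq IH => F a m n r f1 f2 mm nn ff1 ff2.
  by apply: eq_bigr => f /andP[ff _]; apply: eT.
Qed.

Lemma stable_famF s w T : stable s w T -> stable s (w + 1) (famF h T).
Proof.
elim=> {w T} [w|w X l phi XX sX -> gphi|w T1 T2 _ IH1 _ IH2|w T T' eT _ IH].
- apply: stable_eq (stable_zero _ _) => F a m n r f1 f2 *; exact: big1.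
- refine (@stable_eq _ _ _ (fun F a m n r f1 f2 =>
    \sum_(u <- rng m0 n0 | (u == h) || (0 < X h u))
      (phi #|F| a * raise_coef m0 n0 h u X #|F| a) * famM (shift (-1) h u X) a f1 f2) _ _).
    move=> F a m n r f1 f2 mm nn ff1 ff2.
    rewrite /famF -mulr_sumr; have := famF_M le_mn0 le_mh lt_hn XX a mm nn ff1 ff2.
    by rewrite /famF => ->; rewrite mulr_sumr; apply: eq_bigr => u _; rewrite mulrA.
  apply: (@stable_sum _ _ _ _ (fun u F a m n r f1 f2 =>
    (phi #|F| a * raise_coef m0 n0 h u X #|F| a) * famM (shift (-1) h u X) a f1 f2)) => u.
  rewrite mem_rng // => hu hc.
  apply: (@stable_term _ _ _ _ (fun q a => phi q a * raise_coef m0 n0 h u X q a))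
    (good_mul gphi (good_stepcoef _ _ _ _)).
  + exact: inXiT_shiftF.
  + by rewrite -wt1 wt_shift // wt1 sX; ring.
  + rewrite /len wt_shift //; case: ltgtP => ? /=; lia.
- apply: stable_eq (stable_add IH1 IH2).
  by move=> F a m n r f1 f2 *; rewrite /famF big_split.
- apply: stable_eq IH => F a m n r f1 f2 mm nn ff1 ff2.
  by apply: eq_bigr => f /andP[ff _]; apply: eT.
Qed.

(** Associativity of convolution, with a left factor given by a relation. *)
Lemma famC_E T T' : forall F a m n r (f1 f2 : flagT F (absz (n - m)%R) r),
  famE h (famC T T') a f1 f2 = famC (famE h T) T' a f1 f2.
Proof.
move=> F a m n r f1 f2; rewrite /famE /famC exchange_big /=.
by apply: eq_bigr => f _; rewrite mulr_suml.
Qed.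

Lemma famC_F T T' : forall F a m n r (f1 f2 : flagT F (absz (n - m)%R) r),
  famF h (famC T T') a f1 f2 = famC (famF h T) T' a f1 f2.
Proof.
move=> F a m n r f1 f2; rewrite /famF /famC exchange_big /=.
by apply: eq_bigr => f _; rewrite mulr_suml.
Qed.

End Step.

Lemma famC_eq T1 T2 T' : eqfam m0 n0 T1 T2 -> eqfam m0 n0 (famC T1 T') (famC T2 T').
Proof.
by move=> e F a m n r f1 f2 mm nn ff1 ff2; apply: eq_bigr => f ff; rewrite e.
Qed.

End Stable.

Lemma mxZ_ext (X Y : mxZ) : (forall i j, X i j = Y i j) -> X = Y.
Proof. by move=> XY; do 2!apply: functional_extensionality => ?. Qed.

Lemma seq_max_ex (S : seq int) (P : pred int) : has P S ->
  exists u, [/\ u \in S, P u & forall v, v \in S -> P v -> v <= u].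
Proof.
elim: S => [|x S IH] //= /orP[Px|/IH[u [uS Pu umax]]].
  have [/IH[u [uS Pu umax]]|/hasPn nP] := boolP (has P S); last first.
    exists x; split; rewrite ?mem_head // => v; rewrite inE => /orP[/eqP->//|vS] Pv.
    by have := nP v vS; rewrite Pv.
  have [ux|xu] := lerP u x.
    exists x; split; rewrite ?mem_head // => v; rewrite inE => /orP[/eqP->//|vS] Pv.
    exact: le_trans (umax v vS Pv) ux.
  exists u; split; rewrite ?inE ?uS ?orbT // => v /orP[/eqP->|vS] Pv; first exact: ltW.
  exact: umax.
have [Px|nPx] := boolP (P x); last first.
  exists u; split; rewrite ?inE ?uS ?orbT // => v /orP[/eqP->|vS] Pv; last exact: umax.
  by rewrite Pv in nPx.
have [ux|xu] := lerP u x.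
  exists x; split; rewrite ?mem_head // => v; rewrite inE => /orP[/eqP->//|vS] Pv.
  exact: le_trans (umax v vS Pv) ux.
exists u; split; rewrite ?inE ?uS ?orbT // => v /orP[/eqP->|vS] Pv; first exact: ltW.
exact: umax.
Qed.

(** * The induction for products *)

Section Main.
Variables m0 n0 : int.
Hypothesis le_mn0 : m0 <= n0.
Implicit Types m n i j h u : int.
Notation rg := (inrng m0 n0).

(** Above the diagonal, [u] is the last column with a positive entry and [h] the row of such an
    entry. As [h + 1 <= u], an entry of row [h + 1] beyond [u] would again lie above the diagonal,
    so it vanishes. Below the diagonal the first column is taken, as a maximum over opposites, and
    [h + 1] is the row of the entry. *)
Lemma offdiag_cases A : inXiT m0 n0 A ->
  [\/ forall i j, i != j -> A i j = 0,
      exists h u, [/\ m0 <= h, h < u, u <= n0, 0 < A h u &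
                    forall v, u < v -> A (h + 1) v = 0] |
      exists h u, [/\ m0 <= u, u <= h, h < n0, 0 < A (h + 1) u &
                    forall v, v < u -> A h v = 0]].
Proof.
move=> [A0 Ap].
pose up u := has (fun i => (i < u) && (0 < A i u)) (rng m0 n0).
pose lo u := has (fun i => (- u < i) && (0 < A i (- u))) (rng m0 n0).
have mem i : (i \in rng m0 n0) = rg i by rewrite mem_rng.
have [hup|nup] := boolP (has up (rng m0 n0)).
  have [u [uS /hasP[h hS /andP[hu Ahu]] umax]] := seq_max_ex hup.
  apply: Or32; exists h, u; move: uS hS; rewrite !mem => /andP[mu un] /andP[mh hn].
  split=> // v uv; have [vn|nv] := lerP v n0; last by rewrite A0 // /inrng; lia.
  have h1v : h + 1 != v by lia.
  apply/eqP; rewrite eq_le (Ap _ _ h1v) andbT leNgt; apply/negP => Ahv.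
  suff : v <= u by lia.
  apply: umax; first by rewrite mem /inrng; lia.
  apply/hasP; exists (h + 1); rewrite ?mem /inrng ?Ahv; lia.
have [hlo|nlo] := boolP (has lo [seq - i | i <- rng m0 n0]).
  have [u [/mapP[u' u'S ->] /hasP[h hS]]] := seq_max_ex hlo.
  rewrite opprK => /andP[hu Ahu] umax; apply: Or33; exists (h - 1), u'.
  move: u'S hS; rewrite !mem => /andP[mu un] /andP[mh hn]; rewrite subrK.
  split=> //; try lia.
  move=> v uv; have [vn|nv] := lerP m0 v; last by rewrite A0 // /inrng; lia.
  have h1v : h - 1 != v by lia.
  apply/eqP; rewrite eq_le (Ap _ _ h1v) andbT leNgt; apply/negP => Ahv.
  suff : - v <= - u' by lia.
  apply: umax; first by apply: map_f; rewrite mem /inrng; lia.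
  apply/hasP; exists (h - 1); rewrite ?mem /inrng ?opprK ?Ahv; lia.
apply: Or31 => i j ij; case hij: (rg i && rg j); last by rewrite A0 ?hij.
apply/eqP; rewrite eq_le (Ap _ _ ij) andbT leNgt; apply/negP => Aij.
case/andP: hij => hi hj; have [lij|lji|e] := ltgtP i j.
- case/negP: nup; apply/hasP; exists j; rewrite ?mem //.
  by apply/hasP; exists i; rewrite ?mem // lij.
- case/negP: nlo; apply/hasP; exists (- j); first by apply: map_f; rewrite mem.
  by apply/hasP; exists i; rewrite ?mem // !opprK lji.
- by rewrite e eqxx in ij.
Qed.

Lemma coZ_shift e h u X j : m0 <= h -> h < n0 -> coZ m0 n0 (shift e h u X) j = coZ m0 n0 X j.
Proof.
move=> mh hn; rewrite /coZ /shift sumrB big_split /=.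
have S i : \sum_(k <- rng m0 n0) (if (k == i) && (j == u) then e else 0)
  = if rg i then (if j == u then e else 0) else 0.
  rewrite -sum_rng1 //; apply: eq_bigr => k _; by case: eqP.
rewrite !S; have -> : rg h by rewrite /inrng; lia.
have -> : rg (h + 1) by rewrite /inrng; lia.
by rewrite addrK.
Qed.

(** A diagonal position forces the intermediate flag to be [f1]. The position of [f1] relative to
    itself lists the dimensions of its graded pieces, which are the row sums of [typ f1 f2], and
    these agree with [A] because co(A) = ro(B). So [A] acts as a left identity on [B]. *)
Lemma famC_diag A B : inXiT m0 n0 A -> inXiT m0 n0 B ->
  (forall j, rg j -> coZ m0 n0 A j = roZ m0 n0 B j) ->
  (forall i j, i != j -> A i j = 0) ->
  eqfam m0 n0 (famC (famM A) (famM B)) (famM B).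
Proof.
move=> AA BB AB A0 F a m n r f1 f2 mm nn ff1 ff2; have mn : m <= n by lia.
have ext0 i j : i != j -> ext a m n A i j = 0.
  by move=> ij; rewrite /ext A0 // (negPf ij).
rewrite /famC (bigD1 f1) //= big1 ?addr0 => [|f /andP[ff ne]]; last first.
  rewrite /famM; case: eqZmxP => // e; last by rewrite mul0r.
  case/eqP: ne; apply: (diag_typ_eq mn ff ff1) => i j hi hj ij.
  by rewrite typC // e // ext0 // eq_sym.
rewrite /famM; case: (eqZmxP (typ f1 f2)) => // e; last by rewrite mulr0.
suff -> : eqZmx m n (typ f1 f1) (ext a m n A) by rewrite mul1r.
apply/eqZmxP => // i j hi hj; rewrite typ_self //.
case: (eqVneq i j) => [<-|ij]; last by rewrite ext0.
rewrite -(@sum_typ_row _ _ _ _ mn f1 f2) //.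
rewrite (_ : \sum_(j <- rng m n) _ = \sum_(j <- rng m n) if true then ext a m n B i j else 0);
  last by apply: eq_big_seq => k; rewrite mem_rng // => hk; rewrite e.
case hi0: (rg i); last first.
  transitivity (\sum_(j <- rng m n) if j == i then a else 0).
    apply: eq_bigr => k _; rewrite /ext (inXiT_out BB) ?hi0 // hi andbT add0r.
    by rewrite eq_sym.
  by rewrite sum_rng1 // hi /ext (inXiT_out AA) ?hi0 // eqxx hi add0r.
rewrite (sum_ext_row le_mn0 a (i := i) predT) // /ext eqxx hi /=; congr (_ + _).
rewrite -[LHS]/(roZ m0 n0 B i) -AB // /coZ.
rewrite (bigD1_seq i) ?rng_uniq ?mem_rng //= big1 ?addr0 // => k ki; exact: A0.
Qed.

(** One induction step, shared by [famE h] and [famF h]: the move [G] applied to [A'] is c_u A plus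
    other terms, so convolving with [B] allows to solve for the product of [A] and [B]. A term whose
    coefficient has degree [k] may only have weight [w - 2 k]. *)
Lemma famC_step (G : pairfam -> pairfam) A A' B (P : pred int)
    (c : int -> nat -> int -> rat) (AA : int -> mxZ) u s w :
  (forall T T' F a m n r (f1 f2 : flagT F (absz (n - m)%R) r),
     G (famC T T') F a m n r f1 f2 = famC (G T) T' a f1 f2) ->
  (forall T, stable m0 n0 s (w - 1) T -> stable m0 n0 s w (G T)) ->
  eqfam m0 n0 (G (famM A')) (fun F a m n r f1 f2 =>
     \sum_(v <- rng m0 n0 | P v) c v #|F| a * famM (AA v) a f1 f2) ->
  rg u -> P u -> AA u = A ->
  good 0 (fun q a => (c u q a)^-1) -> (forall q a, (1 < q)%N -> c u q a != 0) ->
  stable m0 n0 s (w - 1) (famC (famM A') (famM B)) ->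
  (forall v, rg v -> P v -> v != u -> exists2 k : nat, good k (c v) &
     stable m0 n0 s (w - 2 * k%:Z) (famC (famM (AA v)) (famM B))) ->
  stable m0 n0 s w (famC (famM A) (famM B)).
Proof.
move=> GC Gst GM hu Pu Au gcu cu0 stA' stv.
pose T : pairfam := fun F a m n r f1 f2 => G (famC (famM A') (famM B)) F a m n r f1 f2
  - \sum_(v <- rng m0 n0 | P v && (v != u)) c v #|F| a * famC (famM (AA v)) (famM B) a f1 f2.
have stT : stable m0 n0 s w T.
  refine (stable_sub le_mn0 (T1 := G (famC (famM A') (famM B))) (Gst _ stA') _).
  apply: (@stable_sum _ _ _ _ _ _ (fun v F a m n r f1 f2 =>
     c v #|F| a * famC (famM (AA v)) (famM B) a f1 f2)) => v.
  rewrite mem_rng // => hv /andP[Pv vu]; have [k gk stk] := stv v hv Pv vu.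
  by have := stable_scale le_mn0 gk stk; rewrite subrK.
have := stable_scale le_mn0 gcu stT; rewrite mulr0 addr0; apply: stable_eq.
move=> F a m n r f1 f2 mm nn ff1 ff2; rewrite /T GC.
rewrite (famC_eq (famM B) GM) //.
have -> : famC (fun F a m n r f1 f2 => \sum_(v <- rng m0 n0 | P v) c v #|F| a * famM (AA v) a f1 f2)
    (famM B) a f1 f2 = \sum_(v <- rng m0 n0 | P v) c v #|F| a * famC (famM (AA v)) (famM B) a f1 f2.
  rewrite /famC; under eq_bigr do rewrite mulr_suml.
  rewrite exchange_big /=; apply: eq_bigr => v _.
  by rewrite mulr_sumr; apply: eq_bigr => f _; rewrite mulrA.
rewrite big_mkcond (bigD1_seq u) ?rng_uniq ?mem_rng //= Pu -big_mkcondl addrK Au mulKf //.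
exact/cu0/natr_q1.
Qed.

Lemma sqlen_ge0 A : inXiT m0 n0 A -> 0 <= sqlen m0 n0 A.
Proof.
move=> AA; apply: sumr_ge0 => i _; apply: sumr_ge0 => j _.
have [->|ij] := eqVneq i j; first by rewrite subrr mul0r.
by rewrite mulr_ge0 ?sqr_ge0 // AA.2.
Qed.

Lemma len_diag A : (forall i j, i != j -> A i j = 0) -> len m0 n0 A = 0.
Proof.
move=> A0; apply: big1 => i _; apply: big1 => j _.
by have [->|ij] := eqVneq i j; rewrite ?subrr ?normr0 ?mul0r // A0 // mulr0.
Qed.

(** The weight is additive because [A'] has length one less than [A], and one move raises the weight
    by one. *)
Lemma famC_stable A B : inXiT m0 n0 A -> inXiT m0 n0 B ->
  (forall j, rg j -> coZ m0 n0 A j = roZ m0 n0 B j) ->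
  stable m0 n0 (sigmaZ m0 n0 B) (len m0 n0 A + len m0 n0 B) (famC (famM A) (famM B)).
Proof.
move=> AA BB; have : sqlen m0 n0 A < (absz (sqlen m0 n0 A)).+1 :> int.
  by have := sqlen_ge0 AA; lia.
move: (absz _).+1 => N; elim: N => [|N IH] in A AA *.
  by have := sqlen_ge0 AA; lia.
move=> lN AB.
(* The change of [sqlen] caused by a move in column [v] is monotone in [v]: the extreme column gives
   the term of largest [sqlen]. *)
have sqd h v : (h - v) ^+ 2 - (h + 1 - v) ^+ 2 = 2 * (v - h) - 1 :> int by ring.
case: (offdiag_cases AA) => [A0|[h [u [mh hu un Ahu max]]]|[h [u [mu uh hn Ahu min]]]].
- rewrite len_diag // add0r; apply: stable_eq (famC_diag AA BB AB A0) _.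
  apply: (@stable_eq _ _ _ _ _ (fun F a m n r f1 f2 => 1 * famM B a f1 f2)).
    by move=> F a m n r f1 f2 *; rewrite mul1r.
  apply: (@stable_term _ _ _ _ _ 0 (fun _ _ => 1)) => //; [lia|exact: (good_const 1)].
- have hn : h < n0 by lia.
  have hh : rg h by rewrite /inrng; lia.
  have hh1 : rg (h + 1) by rewrite /inrng; lia.
  have ru : rg u by rewrite /inrng; lia.
  pose A' := shift (- 1) h u A.
  have AA' : inXiT m0 n0 A' by apply: inXiT_shiftF; rewrite ?Ahu ?orbT.
  have cA' j : rg j -> coZ m0 n0 A' j = roZ m0 n0 B j by move=> hj; rewrite coZ_shift // AB.
  have EA : shift 1 h u A' = A.
    by apply: mxZ_ext => i j; rewrite -[1]opprK shiftK.
  have lA : len m0 n0 A = len m0 n0 A' + (`|h - u| - `|h + 1 - u|).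
    by rewrite -{1}EA /len wt_shift // mul1r.
  have sA : sqlen m0 n0 A = sqlen m0 n0 A' + (2 * (u - h) - 1).
    by rewrite -{1}EA /sqlen wt_shift // mul1r sqd.
  have A'u : A' h u = A h u - 1.
    by rewrite /A' /shift !eqxx (_ : h == h + 1 = false) /=; lia.
  have A'h1 v : v != u -> A' (h + 1) v = A (h + 1) v.
    by move=> /negPf vu; rewrite /A' /shift vu !andbF addr0 subr0.
  have A'h1u : A' (h + 1) u = A (h + 1) u + 1.
    by rewrite /A' /shift !eqxx (_ : h + 1 == h = false) /=; lia.
  have Pu : (u == h + 1) || (0 < A' (h + 1) u).
    by case: eqP => //= ne; rewrite A'h1u; have := AA.2 (h + 1) u; lia.
  (* As [h < u], the diagonal entry of row [h] lies to the left of [u], so [a] does not enter this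
     coefficient. *)
  have coefu : lower_coef m0 n0 h u A'
     = stepcoef (\sum_(j <- rng m0 n0) if u < j then A' h j else 0) (A' h u + 1) false false.
    have -> : false = (u < h) by lia.
    by rewrite /lower_coef; have -> : (u == h) = (u < h) by lia.
  have Ac : 0 < A' h u + 1 by rewrite A'u; lia.
  apply: (famC_step (c := fun v => lower_coef m0 n0 h v A') (AA := fun v => shift 1 h v A')
    (famC_E h) _ (famE_M le_mn0 mh hn AA') ru Pu EA).
  + by move=> T sT; have := stable_famE le_mn0 mh hn sT; rewrite subrK.
  + by rewrite coefu; apply: good_stepcoef_inv.
  + by move=> q a q1; rewrite coefu stepcoef_neq0.
  + have -> : len m0 n0 A + len m0 n0 B - 1 = len m0 n0 A' + len m0 n0 B by lia.
    by apply: IH => //; lia.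
  move=> v hv Pv vu; exists ((v < h)%R + (v == h))%N; first exact: good_stepcoef.
  have AAv : inXiT m0 n0 (shift 1 h v A') by apply: inXiT_shiftE.
  have lAv : len m0 n0 (shift 1 h v A') = len m0 n0 A' + (`|h - v| - `|h + 1 - v|).
    by rewrite /len wt_shift // mul1r.
  have sAv : sqlen m0 n0 (shift 1 h v A') = sqlen m0 n0 A' + (2 * (v - h) - 1).
    by rewrite /sqlen wt_shift // mul1r sqd.
  (* A column beyond [u] exceeds [h + 1], so it would need a positive entry in row [h + 1]; the
     choice of [u] excludes this. *)
  have vlt : v < u.
    rewrite lt_neqAle vu leNgt; apply/negP => uv.
    by move: Pv; rewrite A'h1 // max // ltxx orbF; lia.
  have -> : len m0 n0 A + len m0 n0 B - 2 * ((v < h)%R + (v == h))%N%:Z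
     = len m0 n0 (shift 1 h v A') + len m0 n0 B.
    by rewrite lAv lA; case: (ltgtP v h) => ? /=; lia.
  apply: IH => //; first by lia.
  by move=> j hj; rewrite coZ_shift // cA'.
- have mh : m0 <= h by lia.
  have hh : rg h by rewrite /inrng; lia.
  have hh1 : rg (h + 1) by rewrite /inrng; lia.
  have ru : rg u by rewrite /inrng; lia.
  pose A' := shift 1 h u A.
  have AA' : inXiT m0 n0 A' by apply: inXiT_shiftE; rewrite ?Ahu ?orbT.
  have cA' j : rg j -> coZ m0 n0 A' j = roZ m0 n0 B j by move=> hj; rewrite coZ_shift // AB.
  have EA : shift (-1) h u A' = A.
    by apply: mxZ_ext => i j; rewrite shiftK.
  have lA : len m0 n0 A = len m0 n0 A' - (`|h - u| - `|h + 1 - u|).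
    by rewrite -{1}EA /len wt_shift // mulN1r.
  have sA : sqlen m0 n0 A = sqlen m0 n0 A' - (2 * (u - h) - 1).
    by rewrite -{1}EA /sqlen wt_shift // mulN1r sqd.
  have A'u : A' (h + 1) u = A (h + 1) u - 1.
    by rewrite /A' /shift !eqxx (_ : h + 1 == h = false) /=; lia.
  have A'h v : v != u -> A' h v = A h v.
    by move=> /negPf vu; rewrite /A' /shift vu !andbF addr0 subr0.
  have A'hu : A' h u = A h u + 1.
    by rewrite /A' /shift !eqxx (_ : h == h + 1 = false) /=; lia.
  have Pu : (u == h) || (0 < A' h u).
    by case: eqP => //= ne; rewrite A'hu; have := AA.2 h u; lia.
  have coefu : raise_coef m0 n0 h u A'
     = stepcoef (\sum_(j <- rng m0 n0) if j < u then A' (h + 1) j else 0)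
         (A' (h + 1) u + 1) false false.
    have -> : false = (h + 1 < u) by lia.
    by rewrite /raise_coef; have -> : (u == h + 1) = (h + 1 < u) by lia.
  have Ac : 0 < A' (h + 1) u + 1 by rewrite A'u; lia.
  apply: (famC_step (c := fun v => raise_coef m0 n0 h v A') (AA := fun v => shift (-1) h v A')
    (famC_F h) _ (famF_M le_mn0 mh hn AA') ru Pu EA).
  + by move=> T sT; have := stable_famF le_mn0 mh hn sT; rewrite subrK.
  + by rewrite coefu; apply: good_stepcoef_inv.
  + by move=> q a q1; rewrite coefu stepcoef_neq0.
  + have -> : len m0 n0 A + len m0 n0 B - 1 = len m0 n0 A' + len m0 n0 B by lia.
    by apply: IH => //; lia.
  move=> v hv Pv vu; exists ((h + 1 < v)%R + (v == (h + 1)%R))%N; first exact: good_stepcoef.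
  have AAv : inXiT m0 n0 (shift (-1) h v A') by apply: inXiT_shiftF.
  have lAv : len m0 n0 (shift (-1) h v A') = len m0 n0 A' - (`|h - v| - `|h + 1 - v|).
    by rewrite /len wt_shift // mulN1r.
  have sAv : sqlen m0 n0 (shift (-1) h v A') = sqlen m0 n0 A' - (2 * (v - h) - 1).
    by rewrite /sqlen wt_shift // mulN1r sqd.
  have vlt : u < v.
    rewrite lt_neqAle eq_sym vu leNgt; apply/negP => uv.
    by move: Pv; rewrite A'h // min // ltxx orbF; lia.
  have -> : len m0 n0 A + len m0 n0 B - 2 * ((h + 1 < v)%R + (v == (h + 1)%R))%N%:Z
     = len m0 n0 (shift (-1) h v A') + len m0 n0 B.
    by rewrite lAv lA; case: (ltgtP (h + 1) v) => ? /=; lia.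
  apply: IH => //; first by lia.
  by move=> j hj; rewrite coZ_shift // cA'.
Qed.

End Main.

(** * Nonemptiness of orbits *)

Section Coord.
Variables (F : fieldType) (r : nat).
Implicit Types P Q : pred 'I_r.

(** The span of the basis vectors indexed by [P], as a diagonal idempotent, so that intersections
    become products. *)
Definition coordmx P : 'M[F]_r := diag_mx (\row_k (P k)%:R).

Lemma mul_coordmx P Q : coordmx P *m coordmx Q = coordmx (predI P Q).
Proof.
rewrite /coordmx mulmx_diag; congr diag_mx; apply/rowP => k.
by rewrite !mxE /= -mulnb natrM.
Qed.

Lemma rank_coordmx_le P : (\rank (coordmx P) <= #|P|)%N.
Proof.
have -> : coordmx P = \sum_(k | P k) delta_mx k k.
  rewrite /coordmx diag_mx_sum_delta [RHS]big_mkcond /=; apply: eq_bigr => k _.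
  by rewrite mxE; case: (P k); rewrite ?scale1r ?scale0r.
rewrite -sum1_card; elim/big_rec2: _ => [|k s A Pk le]; first by rewrite mxrank0.
by rewrite (leq_trans (mxrank_add _ _)) // leq_add // mxrank_delta.
Qed.

(** The upper bounds for [P] and for its complement add up to [r], and the two matrices add up to
    the identity, so both bounds are attained. *)
Lemma rank_coordmx P : \rank (coordmx P) = #|P|.
Proof.
apply/eqP; rewrite eqn_leq rank_coordmx_le /=.
pose Q : pred 'I_r := fun k => ~~ P k.
have cP : (#|P| + #|Q| = r)%N.
  by rewrite -[RHS]card_ord -(cardC P); congr (_ + _)%N; apply: eq_card.
have : (r <= \rank (coordmx P) + \rank (coordmx Q))%N; last first.
  by have := rank_coordmx_le Q; move: cP; lia.
rewrite (leq_trans _ (mxrank_add _ _)) //.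
suff -> : coordmx P + coordmx Q = 1%:M by rewrite mxrank1.
apply/matrixP => k l; rewrite !mxE /Q; case: (P k); case: (k == l);
  by rewrite ?mulr0n ?mulr1n ?addr0 ?add0r.
Qed.

Lemma coordmxS P Q : {subset P <= Q} -> (coordmx P <= coordmx Q)%MS.
Proof.
move=> PQ; suff <- : coordmx P *m coordmx Q = coordmx P by apply: submxMl.
rewrite mul_coordmx; congr diag_mx; apply/rowP => k; rewrite !mxE /=.
by case Pk: (P k) => //=; have := PQ k; rewrite /in_mem /= Pk => ->.
Qed.

Lemma rank_cap_coordmx P Q : \rank (coordmx P :&: coordmx Q)%MS = #|predI P Q|.
Proof.
rewrite -rank_coordmx; apply/eqmx_rank; apply/andP; split; last first.
  by rewrite sub_capmx !coordmxS // => k /andP[].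
have idem R k (A : 'M_(k, r)) : (A <= coordmx R)%MS -> A *m coordmx R = A.
  move=> /submxP[D ->]; rewrite -mulmxA mul_coordmx; congr (_ *m diag_mx _).
  by apply/rowP => l; rewrite !mxE /= andbb.
have <- : (coordmx P :&: coordmx Q)%MS *m coordmx (predI P Q) = (coordmx P :&: coordmx Q)%MS.
  by rewrite -mul_coordmx mulmxA (idem P) ?capmxSl // (idem Q) ?capmxSr.
exact: submxMl.
Qed.

End Coord.

Lemma count_flatten_map (T U : Type) (P : pred T) (f : U -> seq T) (S : seq U) :
  (count P (flatten [seq f x | x <- S]) : int) = \sum_(x <- S) (count P (f x) : int).
Proof.
by elim: S => [|x S IH] /=; rewrite ?big_nil // big_cons count_cat PoszD IH.
Qed.

Section Orbit.
Variables (F : finFieldType) (m n : int) (r : nat).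
Hypothesis le_mn : m <= n.

(** Basis vectors are labelled by pairs, with c_ij of them labelled (i, j); the two flags filter the
    basis by the first and by the second label. This is needed because [flagcount] divides by the
    number of pairs in the orbit. *)
Lemma orbit_nonempty C : inXi m n r%:Z C ->
  exists f1 f2 : flagT F (absz (n - m)%R) r,
    [/\ isflag f1, isflag f2 & eqZmx m n (typ f1 f2) C].
Proof.
move=> [C0 [Cp Cr]].
pose s : seq (int * int) :=
  flatten [seq flatten [seq nseq (absz (C i j)) (i, j) | j <- rng m n] | i <- rng m n].
have cnt (P : pred (int * int)) : (count P s : int)
   = \sum_(i <- rng m n) \sum_(j <- rng m n) if P (i, j) then C i j else 0.
  rewrite /s count_flatten_map; apply: eq_bigr => i _.
  rewrite count_flatten_map; apply: eq_bigr => j _.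
  by rewrite count_nseq; case: (P _); rewrite ?mul0n // mul1n; have := Cp i j; lia.
have ss : size s = r.
  apply/eqP; rewrite -count_predT -eqz_nat cnt /=; exact/eqP.
pose b (k : 'I_r) : int * int := nth (0, 0) s k.
have cardb (P : pred (int * int)) : #|[pred k | P (b k)]| = count P s.
  rewrite -sum1_card -sum1_count (big_nth (0, 0)) ss big_mkord.
  exact: eq_bigl.
pose f1 : flagT F (absz (n - m)%R) r :=
  @mkflag F m n r (fun i => coordmx F [pred k | (b k).1 <= i]).
pose f2 : flagT F (absz (n - m)%R) r :=
  @mkflag F m n r (fun j => coordmx F [pred k | (b k).2 <= j]).
have inb k : inrng m n (b k).1 && inrng m n (b k).2.
  have : b k \in s by apply: mem_nth; rewrite ss.
  move=> /flattenP[t /mapP[i hi ->]] /flattenP[t' /mapP[j hj ->]].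
  by move=> /nseqP[-> _] /=; rewrite -!mem_rng // hi.
have fl (p : int * int -> int) : (forall k, inrng m n (p (b k))) ->
    isflag (@mkflag F m n r (fun i => coordmx F [pred k | p (b k) <= i])).
  move=> hp; apply: isflag_mkflag => // [i mi ni|].
    by apply: coordmxS => k; rewrite !inE => /le_trans; apply; rewrite lerDl.
  have [_ <-] := mxrank_leqif_sup (submx1 (coordmx F [pred k | p (b k) <= n])).
  rewrite mxrank1 rank_coordmx -[X in _ == X]card_ord; apply/eqP/eq_card => k.
  by rewrite !inE; have /andP[] := hp k.
have ff1 : isflag f1 by apply: (fl fst) => k; have /andP[] := inb k.
have ff2 : isflag f2 by apply: (fl snd) => k; have /andP[] := inb k.
exists f1, f2; split=> //.
have D i j : m - 1 <= i -> i <= n -> m - 1 <= j -> j <= n -> rkcap f1 f2 i j =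
   \sum_(k <- rng m n) \sum_(l <- rng m n) if (k <= i) && (l <= j) then C k l else 0.
  move=> mi ni mj nj.
  have big0 (P : int -> int -> bool) : (forall k l, inrng m n k -> inrng m n l -> ~~ P k l) ->
     0 = \sum_(k <- rng m n) \sum_(l <- rng m n) (if P k l then C k l else 0).
    move=> nP; rewrite big1_seq // => k /andP[_]; rewrite mem_rng // => hk.
    rewrite big1_seq // => l /andP[_]; rewrite mem_rng // => hl.
    by rewrite (negPf (nP k l hk hl)).
  have [mi'|im] := lerP m i; last first.
    have -> : i = m - 1 by lia.
    by rewrite rkcap_bot //; apply: big0 => k l; rewrite /inrng; lia.
  have [mj'|jm] := lerP m j; last first.
    have -> : j = m - 1 by lia.
    by rewrite rkcapC rkcap_bot //; apply: big0 => k l; rewrite /inrng; lia.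
  rewrite /rkcap !flv_mkflag ?/inrng ?mi' ?mj' //.
  pose Pi := [pred k | (b k).1 <= i]; pose Pj := [pred k | (b k).2 <= j].
  rewrite (eqmx_rank (B := (coordmx F Pi :&: coordmx F Pj)%MS)); last first.
    by apply/eqmxP/cap_eqmx; apply: genmxE.
  rewrite rank_cap_coordmx (cardb (fun p => (p.1 <= i) && (p.2 <= j))) cnt //.
apply/eqZmxP => // i j hi hj; rewrite typE //.
move: (hi) (hj) => /inrngP[mi ni] /inrngP[mj nj]; rewrite !D; [|lia..].
rewrite -!sumrB -big_split /= (bigD1_seq i) ?rng_uniq ?mem_rng //= [X in _ + X]big1 ?addr0.
  rewrite -!sumrB -big_split /= (bigD1_seq j) ?rng_uniq ?mem_rng //= [X in _ + X]big1 ?addr0.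
    have -> : i <= i - 1 = false by lia.
    have -> : j <= j - 1 = false by lia.
    by rewrite !lexx /=; ring.
  move=> l lj; rewrite lexx (_ : i <= i - 1 = false) /=; last by lia.
  have -> : (l <= j - 1) = (l <= j) by lia.
  by ring.
move=> k ki; rewrite -!sumrB -big_split big1 //= => l _.
have -> : (k <= i - 1) = (k <= i) by lia.
by ring.
Qed.
End Orbit.

(** * Hall polynomials *)

(** If the number of intermediate flags is the same [x] for all pairs of the orbit, there are [x]
    times as many triples as pairs, and the division in [flagcount] is exact. *)
Lemma flagcount_famC (F : finFieldType) (m n : int) (r : nat) (A B C : mxZ) (a : int) (x : rat) :
  m <= n -> inXi m n r%:Z C ->
  (forall f1 f2 : flagT F (absz (n - m)%R) r, isflag f1 -> isflag f2 ->
     eqZmx m n (typ f1 f2) C -> famC (famM A) (famM B) a f1 f2 = x) ->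
  (flagcount m n r (ext a m n A) (ext a m n B) C F)%:R = x.
Proof.
move=> mn CC Nx.
set fl := flagT F (absz (n - m)%R) r.
pose pairs : {set fl * fl} := [set p | [&& isflag p.1, isflag p.2 & eqZmx m n (typ p.1 p.2) C]].
pose N (p : fl * fl) := #|[set f : fl | [&& isflag f, eqZmx m n (typ p.1 f) (ext a m n A) &
   eqZmx m n (typ f p.2) (ext a m n B)]]|.
have NE p : p \in pairs -> (N p)%:R = x.
  rewrite inE => /and3P[f1 f2 e]; rewrite -(Nx _ _ f1 f2 e) /N -sum1_card natr_sum /famC.
  rewrite big_mkcond [RHS]big_mkcond /=; apply: eq_bigr => f _; rewrite inE /famM.
  by case: isflag => //=; do 2!case: eqZmx; rewrite /= ?mulr1 ?mulr0.
have [g1 [g2 [fg1 fg2 tg]]] := orbit_nonempty F mn CC.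
have p0 : (g1, g2) \in pairs by rewrite inE /= fg1 fg2.
rewrite /flagcount -/fl.
rewrite (_ : #|_| = (#|pairs| * N (g1, g2))%N).
  by rewrite mulKn ?NE //; apply/card_gt0P; exists (g1, g2).
rewrite -sum_nat_const -sum1_card.
rewrite (partition_big (fun t => (t.1.1, t.2)) (mem pairs)) /=; last first.
  by move=> [[f1 f] f2]; rewrite !inE /= => /and5P[-> _ -> _ /andP[_ ->]].
apply: eq_bigr => -[f1 f2] pp.
have -> : N (g1, g2) = N (f1, f2) by apply/eqP; rewrite -(eqr_nat rat) !NE.
rewrite /N -sum1_card.
rewrite (reindex_onto (fun f : fl => (f1, f, f2)) (fun t => t.1.2)) /=; last first.
  by move=> [[h1 h] h2] /andP[_ /eqP[-> ->]].
apply: eq_bigl => f; rewrite !inE /= !eqxx !andbT.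
by move: pp; rewrite inE /= => /and3P[-> -> ->]; rewrite andbT.
Qed.

(** The extra factor [q] on the left avoids the exponent [s - 1], so that [s = 0] is covered. *)
Lemma horner_bound (p : {poly int}) (s q : nat) : (size p <= s)%N -> (0 < q)%N ->
  `|p.[q%:Z]| * q%:Z <= (\sum_(k < s) `|p`_k|) * q%:Z ^+ s.
Proof.
move=> ps q0; rewrite (horner_coef_wide _ ps).
apply: le_trans (ler_wpM2r _ (ler_norm_sum _ _ _)) _ => //.
rewrite !mulr_suml; apply: ler_sum => k _; rewrite normrM -mulrA ler_wpM2l //.
rewrite normrX ger0_norm // -exprSr ler_weXn2l //; lia.
Qed.

Lemma poly_dominate (d p : {poly int}) : d != 0 -> (size p < size d)%N ->
  exists N : nat, forall q : nat, (N < q)%N -> `|p.[q%:Z]| < `|d.[q%:Z]|.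
Proof.
move=> d0 pd; pose s := (size d).-1.
have sd : size d = s.+1 by rewrite /s prednK // lt0n size_poly_eq0.
pose e := d - lead_coef d *: 'X^s.
have se : (size e <= s)%N.
  apply/leq_sizeP => j sj; rewrite coefB coefZ coefXn lead_coefE -/s.
  have [->|js] := eqVneq j s; first by rewrite mulr1 subrr.
  by rewrite mulr0 subr0 nth_default // sd; lia.
have sp : (size p <= s)%N by rewrite -ltnS -sd.
pose Be := \sum_(k < s) `|e`_k|; pose Bp := \sum_(k < s) `|p`_k|.
(* Beyond the sum of the absolute values of the coefficients of [p] and of the lower coefficients of
   [d], the leading term of [d] dominates. *)
exists (absz (Be + Bp)) => q Nq.
have q0 : (0 < q)%N by lia.
have he := horner_bound se q0; have hp := horner_bound sp q0.
have dE : d.[q%:Z] = lead_coef d * q%:Z ^+ s + e.[q%:Z].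
  by rewrite /e hornerD hornerN hornerZ hornerXn; ring.
have ld : 1 <= `|lead_coef d|.
  by rewrite -gtz0_ge1 normr_gt0 lead_coef_eq0.
have qs : 0 < q%:Z ^+ s :> int by rewrite exprn_gt0 // ltz_nat.
have h1 : q%:Z ^+ s <= `|d.[q%:Z]| + `|e.[q%:Z]|.
  have : q%:Z ^+ s <= `|lead_coef d * q%:Z ^+ s|.
    by rewrite normrM (gtr0_norm qs) ler_peMl // ltW.
  have -> : lead_coef d * q%:Z ^+ s = d.[q%:Z] - e.[q%:Z] by rewrite dE; ring.
  by move=> /le_trans; apply; apply: ler_normB.
have Bge : Be + Bp < q%:Z by lia.
rewrite -/Be in he; rewrite -/Bp in hp.
rewrite -(ltr_pM2r (x := q%:Z)); last by rewrite ltz_nat.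
have h2 : (Be + Bp) * q%:Z ^+ s < q%:Z * q%:Z ^+ s by rewrite ltr_pM2r.
have h3 : q%:Z ^+ s * q%:Z <= (`|d.[q%:Z]| + `|e.[q%:Z]|) * q%:Z by rewrite ler_wpM2r.
rewrite mulrDl in h2; rewrite mulrDl mulrC in h3.
apply: le_lt_trans hp _; rewrite -(ltrD2l (Be * q%:Z ^+ s)); apply: lt_le_trans h2 _.
by apply: le_trans h3 _; rewrite addrC lerD2r.
Qed.

Lemma poly_eventually_neq0 (d : {poly int}) : d != 0 ->
  exists N : nat, forall q : nat, (N < q)%N -> d.[q%:Z] != 0.
Proof.
move=> d0; have [|N hN] := @poly_dominate d 0 d0.
  by rewrite size_poly0 lt0n size_poly_eq0.
by exists N => q /hN; rewrite horner0 normr0 normr_gt0.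
Qed.

Lemma poly_eq_at_fields (g g' : {poly int}) :
  (forall F : finFieldType, g.[#|F|%:Z] = g'.[#|F|%:Z]) -> g = g'.
Proof.
move=> e; apply/eqP; rewrite -subr_eq0; apply/negPn/negP => d0.
have [N hN] := poly_eventually_neq0 d0.
have [p Np pp] := prime_above N.
by have := hN p Np; rewrite hornerD hornerN -(card_Fp pp) -e subrr eqxx.
Qed.

(* An integer-valued quotient [P/D] with [D] monic has zero remainder, since the remainder
   is eventually dominated by [D]. *)
Lemma gpoly_quotient (m n : int) (r : nat) A B C (D P : {poly int}) : good_den D ->
  (forall F : finFieldType, (flagcount m n r A B C F)%:R = qeval #|F| P / qeval #|F| D) ->
  gpoly m n r A B C * D = P.
Proof.
move=> [mD nD] cnt.
have cntz (F : finFieldType) : (flagcount m n r A B C F)%:Z * D.[#|F|%:Z] = P.[#|F|%:Z].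
  have nDF := nD _ (natr_q1 F); apply/eqP; rewrite -(eqr_int rat) rmorphM /=.
  by rewrite -pmulrn cnt /qeval divfK.
have Dn0 : D != 0 by apply: monic_neq0.
have PE := Pdiv.RingMonic.rdivp_eq mD P.
have sr : (size (Pdiv.Ring.rmodp P D) < size D)%N by rewrite Pdiv.Ring.ltn_rmodp.
set hq := Pdiv.CommonRing.rdivp P D in PE; set rem := Pdiv.CommonRing.rmodp P D in PE sr.
have rem0 : rem = 0.
  apply/eqP/negPn/negP => rn0.
  have [N1 h1] := poly_dominate Dn0 sr.
  have [N2 h2] := poly_eventually_neq0 rn0.
  have [p Np pp] := prime_above (maxn N1 N2).
  have /h1 d1 : (N1 < p)%N by lia.
  have /h2 d2 : (N2 < p)%N by lia.
  have := cntz 'F_p; rewrite card_Fp // PE hornerD hornerM => e.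
  have er : rem.[p%:Z] = ((flagcount m n r A B C 'F_p)%:Z - hq.[p%:Z]) * D.[p%:Z].
    by rewrite mulrBl e; ring.
  move: d1 d2; rewrite er normrM mulf_eq0 negb_or; set c := _ - _ => d1 d2.
  case/andP: d2 => c0 _.
  have : 1 * `|D.[p%:Z]| <= `|c| * `|D.[p%:Z]| by rewrite ler_wpM2r //; lia.
  by rewrite mul1r leNgt d1.
rewrite PE rem0 addr0; congr (_ * _).
(* The quotient meets the specification, so the polynomial picked by [epsilon] meets it too. Both
   then agree at the orders of all finite fields and are equal. *)
have hqP : is_gpoly m n r A B C hq.
  move=> F; have := cntz F; rewrite PE rem0 addr0 hornerM => /mulIf -> //.
  by have := nD _ (natr_q1 F); rewrite /qeval intr_eq0.
have gP : is_gpoly m n r A B C (gpoly m n r A B C).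
  by apply: epsilon_spec; exists hq.
by apply: poly_eq_at_fields => F; rewrite hqP gP.
Qed.

(** * The normalizing exponent *)

Lemma count_rng_between (m n i j : int) : m <= n -> m <= j -> i <= n ->
  \sum_(k <- rng m n) (if (k <= i) && (j < k) then 1 else 0) = if j < i then i - j else 0 :> int.
Proof.
move=> mn mj ni; case: ifP => ji; last first.
  by apply: big1 => k _; case: ifP => //; lia.
(* This is [k] clamped to [j, i]; its increments are the indicator of j < k <= i. *)
pose f (k : int) : int := if k <= j then j else if i <= k then i else k.
transitivity (\sum_(k <- rng m n) (f k - f (k - 1))).
  by apply: eq_bigr => k _; rewrite /f; do ![case: ifP => ?]; lia.
by rewrite sum_rng_telescope // /f; do ![case: ifP => ?]; lia.
Qed.

Section Dmx.
Variables m0 n0 m n : int.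
Hypotheses (le_mn0 : m0 <= n0) (le_mm : m <= m0) (le_nn : n0 <= n).

Implicit Types i j : int.

Let le_mn : m <= n. Proof. by lia. Qed.

Lemma sum2_rng_sub (f : int -> int -> int) :
  (forall i j, ~~ (inrng m0 n0 i && inrng m0 n0 j) -> f i j = 0) ->
  \sum_(i <- rng m n) \sum_(j <- rng m n) f i j
  = \sum_(i <- rng m0 n0) \sum_(j <- rng m0 n0) f i j.
Proof.
move=> f0; rewrite (sum_rng_sub (m0 := m0) (n0 := n0)) //; last first.
  by move=> i hi; apply: big1 => j _; apply: f0; rewrite (negPf hi).
apply: eq_bigr => i _; apply: sum_rng_sub => // j hj.
by rewrite f0 // (negPf hj) andbF.
Qed.

(** There is no term in a^2, since i = j and k = l contradict k <= i and j < l. In the linear terms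
    a_ij is paired with the diagonal positions strictly after j and up to i, and a_kl with those
    from k up to l - 1. Together each entry is counted |i - j| times, whatever [m] and [n] are. *)
Lemma dmx_ext a X : inXiT m0 n0 X ->
  dmx m n (ext a m n X) = dmx m0 n0 X + a * len m0 n0 X.
Proof.
move=> XX; pose c i j k l := (k <= i) && (j < l).
have X0 i j : ~~ (inrng m0 n0 i && inrng m0 n0 j) -> X i j = 0 by apply: inXiT_out.
have -> : dmx m n (ext a m n X) = \sum_(i <- rng m n) \sum_(j <- rng m n)
    ((\sum_(k <- rng m n) \sum_(l <- rng m n) if c i j k l then X i j * X k l else 0)
     + (\sum_(k <- rng m n) \sum_(l <- rng m n) 
        a * X i j * (if c i j k l && (l == k) then 1 else 0))
     + (\sum_(k <- rng m n) \sum_(l <- rng m n) 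
        a * X k l * (if c i j k l && (j == i) then 1 else 0))).
  apply: eq_big_seq => i; rewrite mem_rng // => hi; apply: eq_bigr => j _.
  rewrite -!big_split; apply: eq_big_seq => k; rewrite mem_rng // => hk.
  rewrite -!big_split; apply: eq_bigr => l _; rewrite /= -/(c i j k l) /ext hi hk !andbT.
  rewrite [j == i]eq_sym [l == k]eq_sym; case cE: (c i j k l) => /=; last by ring.
  by case: eqP => e1; case: eqP => e2; try ring; move: cE; rewrite /c; lia.
transitivity ((\sum_(i <- rng m n) \sum_(j <- rng m n)
      \sum_(k <- rng m n) \sum_(l <- rng m n) if c i j k l then X i j * X k l else 0)
   + (\sum_(i <- rng m n) \sum_(j <- rng m n) a * X i j * (if j < i then i - j else 0))
   + (\sum_(k <- rng m n) \sum_(l <- rng m n) a * X k l * (if k < l then l - k else 0))).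
  under eq_bigr do rewrite !big_split /=.
  rewrite !big_split /=; congr (_ + _ + _).
    apply: eq_big_seq => i; rewrite mem_rng // => /inrngP[mi ni].
    apply: eq_big_seq => j; rewrite mem_rng // => /inrngP[mj nj].
    rewrite -(count_rng_between le_mn mj ni) mulr_sumr.
    apply: eq_big_seq => k; rewrite mem_rng // => hk; rewrite -mulr_sumr; congr (_ * _).
    transitivity (\sum_(l <- rng m n)
      if l == k then (if (k <= i) && (j < k) then 1 else 0 : int) else 0).
      by apply: eq_bigr => l _; rewrite /c; case: eqP => [->|_]; rewrite ?andbT ?andbF.
    by rewrite sum_rng1 // hk.
  transitivity (\sum_(i <- rng m n) \sum_(k <- rng m n) \sum_(l <- rng m n)
      a * X k l * (if (i < l) && (k - 1 < i) then 1 else 0)).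
    apply: eq_big_seq => i; rewrite mem_rng // => hi.
    rewrite exchange_big /=; apply: eq_bigr => k _.
    rewrite exchange_big /=; apply: eq_bigr => l _; rewrite -mulr_sumr; congr (_ * _).
    transitivity (\sum_(j <- rng m n)
      if j == i then (if (i < l) && (k - 1 < i) then 1 else 0 : int) else 0).
      apply: eq_bigr => j _; rewrite /c; case: eqP => [->|_]; rewrite ?andbT ?andbF //.
      by rewrite andbC; congr (if _ then _ else _); congr (_ && _); lia.
    by rewrite sum_rng1 // hi.
  rewrite exchange_big /=; apply: eq_big_seq => k; rewrite mem_rng // => /inrngP[mk nk].
  rewrite exchange_big /=; apply: eq_big_seq => l; rewrite mem_rng // => /inrngP[ml nl].
  rewrite -mulr_sumr; congr (_ * _).
  transitivity (\sum_(i <- rng m n) (if (i + 1 <= l) && (k < i + 1) then 1 else 0 : int)).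
    by apply: eq_bigr => i _; congr (if _ then _ else _); congr (_ && _); lia.
  case: ifP => kl; last by apply: big1 => i _; case: ifP => //; lia.
  pose f (i : int) : int := if i < k then k else if l <= i then l else i + 1.
  transitivity (\sum_(i <- rng m n) (f i - f (i - 1))).
    by apply: eq_bigr => i _; rewrite /f; do ![case: ifP => ?]; lia.
  by rewrite sum_rng_telescope // /f; do ![case: ifP => ?]; lia.
rewrite !sum2_rng_sub => [||i j hij|i j hij].
- rewrite -addrA; congr (_ + _).
    apply: eq_bigr => i _; apply: eq_bigr => j _; apply: sum2_rng_sub => k l hkl.
    by rewrite (X0 _ _ hkl) mulr0 if_same.
  rewrite /len /wt mulr_sumr -big_split; apply: eq_bigr => i _.
  rewrite mulr_sumr -big_split; apply: eq_bigr => j _ /=.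
  have -> : `|i - j| = (if j < i then i - j else 0) + (if i < j then j - i else 0).
    by case: ltgtP => ?; lia.
  ring.
- by move=> i j hij; rewrite X0 // mulr0 mul0r.
- by rewrite X0 // mulr0 mul0r.
- rewrite X0 //; apply: big1 => k _; apply: big1 => l _.
  by rewrite mul0r if_same.
Qed.

End Dmx.

(** * The ring Z_1 *)

Lemma vv_neq0 : vv != 0.
Proof. by rewrite tofrac_eq0 polyX_eq0. Qed.

Lemma vvX_eq1 (z : int) : vv ^ z = 1 -> z = 0.
Proof.
have nat1 (k : nat) : vv ^+ k = 1 -> k = 0%N.
  rewrite /vv -tofracXn -tofrac1 => /eqP; rewrite tofrac_eq => /eqP.
  move=> /(congr1 (fun p : {poly rat} => size p)).
  by rewrite size_polyXn size_poly1 => -[].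
case: z => k; first by rewrite -exprnP => /nat1->.
by rewrite NegzE -invr_expz => /(canRL invrK); rewrite invr1 => /nat1.
Qed.

(* [Z1gen] over an arbitrary field: unification in [Qv] unfolds the arithmetic of fractions. *)
Definition zgen (K : fieldType) (v : K) (a : int) (t : nat) : {poly K} :=
  \prod_(k < t)
     (((v ^ (- 2 * (a - (k.+1)%:Z))) *: 'X^2 - 1) * ((v ^ (- 2 * (k.+1)%:Z) - 1)^-1)%:P).

Section SubringGen.
Variables (R : comNzRingType) (L : R -> Prop).
Hypotheses (L1 : L 1) (LD : forall x y, L x -> L y -> L (x + y)).
Hypotheses (LN : forall x, L x -> L (- x)) (LM : forall x y, L x -> L y -> L (x * y)).

Lemma subring_intr (z : int) : L z%:~R.
Proof.
have L0 : L 0 by rewrite -(subrr 1); apply: LD L1 (LN L1).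
elim/int_rect: z => [|k IH|k IH]; first by rewrite mulr0z.
  by rewrite intS intrD; apply: LD L1 IH.
by rewrite intS opprD intrD mulrNz mulr1z; apply: LD (LN L1) IH.
Qed.

Lemma subring_horner (g : {poly int}) x : L x -> L (map_poly (fun z : int => z%:~R : R) g).[x].
Proof.
move=> Lx; elim/poly_ind: g => [|g c IH].
  by rewrite rmorph0 horner0; apply: (subring_intr 0).
rewrite rmorphD rmorphM /= map_polyX map_polyC hornerMXaddC.
by apply: LD (LM IH Lx) _; apply: subring_intr.
Qed.

End SubringGen.

(** * Gaussian binomials and interpolation *)

Section Gauss.
Variables (K : fieldType) (v : K) (Z : {poly K} -> Prop).
Hypotheses (v_neq0 : v != 0) (vX_eq1 : forall z : int, v ^ z = 1 -> z = 0).
Hypotheses (Zv : forall j, Z (v ^ j)%:P) (Zgen : forall a t, (0 < t)%N -> Z (zgen v a t)).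
Hypotheses (ZD : forall p q, Z p -> Z q -> Z (p + q)) (ZN : forall p, Z p -> Z (- p)).
Hypothesis (ZM : forall p q, Z p -> Z q -> Z (p * q)).

(** Laurent polynomials enter as the constants of [Z], so that their closure properties are those of
    [Z]. *)
Definition laurent (x : K) := Z x%:P.

Lemma laurent_v j : laurent (v ^ j). Proof. exact: Zv. Qed.
Lemma laurentD x y : laurent x -> laurent y -> laurent (x + y).
Proof. by move=> hx hy; rewrite /laurent polyCD; apply: ZD. Qed.
Lemma laurentN x : laurent x -> laurent (- x).
Proof. by move=> hx; rewrite /laurent polyCN; apply: ZN. Qed.
Lemma laurentM x y : laurent x -> laurent y -> laurent (x * y).
Proof. by move=> hx hy; rewrite /laurent polyCM; apply: ZM. Qed.
Lemma laurent1 : laurent 1. Proof. by rewrite -(expr0z v); apply: laurent_v. Qed.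
Lemma laurent0 : laurent 0.
Proof. by rewrite -(subrr 1); apply: laurentD; [|apply: laurentN]; apply: laurent1. Qed.

Lemma laurent_horner (g : {poly int}) x : laurent x ->
  laurent (map_poly (fun z : int => z%:~R : K) g).[x].
Proof. exact: (subring_horner laurent1 laurentD laurentN laurentM). Qed.

(** The Gaussian binomial coefficient of [s] over [t] in the variable v^-2, for any integer [s]. *)
Definition gbinom (s : int) (t : nat) : K :=
  \prod_(k < t) ((v ^ (- 2 * (s - (k : nat)%:Z)) - 1) / (v ^ (- 2 * (k.+1)%:Z) - 1)).

Lemma v_den_neq0 (k : nat) : v ^ (- 2 * (k.+1)%:Z) - 1 != 0.
Proof. by rewrite subr_eq0; apply/eqP => /vX_eq1; lia. Qed.

Lemma gbinom_pascal s t :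
  gbinom (s + 1) t.+1 = gbinom s t.+1 + v ^ (- 2 * (s - t%:Z)) * gbinom s t.
Proof.
pose num s t : K := \prod_(k < t) (v ^ (- 2 * (s - (k : nat)%:Z)) - 1).
pose den t : K := \prod_(k < t) (v ^ (- 2 * (k.+1)%:Z) - 1)^-1.
have gE s' t' : gbinom s' t' = num s' t' * den t' by rewrite -big_split.
rewrite !gE {1}/num big_ord_recl.
have -> : \prod_(i < t) (v ^ (- 2 * (s + 1 - (lift ord0 i : nat)%:Z)) - 1) = num s t.
  by apply: eq_bigr => i _; congr (_ ^ _ - _); rewrite /= /bump /=; lia.
rewrite {2}/num big_ord_recr /= -/(num s t).
rewrite /den big_ord_recr /= -/(den t).
have -> : - 2 * (s + 1 - 0) = - 2 * (s - t%:Z) + (- 2 * (t.+1)%:Z) by lia.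
rewrite expfzDr ?v_neq0 //; have := v_den_neq0 t.
set Y := v ^ (- 2 * (s - t%:Z)); set Y1 := v ^ (- 2 * (t.+1)%:Z) => Y1n.
by field.
Qed.

Lemma gbinom0l t : gbinom 0 t.+1 = 0.
Proof. by rewrite /gbinom big_ord_recl [X in v ^ X](_ : _ = 0) // expr0z subrr !mul0r. Qed.

Lemma gbinom_small (s t : nat) : (s < t)%N -> gbinom s t = 0.
Proof.
move=> st; rewrite /gbinom (bigD1 (Ordinal st)) //=.
by rewrite subrr mulr0 expr0z subrr !mul0r.
Qed.

Lemma gbinomnn (t : nat) : gbinom t t = 1.
Proof.
elim: t => [|t IH]; first exact: big_ord0.
rewrite -[X in gbinom X]/((t.+1)%:Z) -addn1 PoszD addn1 gbinom_pascal gbinom_small // IH.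
by rewrite subrr mulr0 expr0z add0r mulr1.
Qed.

(** The Pascal rule, read upwards from [s = 0] and downwards for negative [s], inside an induction
    on [t]. *)
Lemma laurent_gbinom s t : laurent (gbinom s t).
Proof.
elim: t s => [|t IH] s; first by rewrite /gbinom big_ord0; apply: laurent1.
elim/int_rect: s => [|k IHk|k IHk]; first by rewrite gbinom0l; apply: laurent0.
  rewrite intS addrC gbinom_pascal; apply: laurentD => //.
  by apply: laurentM; [apply: laurent_v|apply: IH].
have := gbinom_pascal (- (k.+1)%:Z) t.
have -> : - (k.+1)%:Z + 1 = - k%:Z by lia.
move=> e; have -> : gbinom (- (k.+1)%:Z) t.+1
    = gbinom (- k%:Z) t.+1 - v ^ (- 2 * (- (k.+1)%:Z - t%:Z)) * gbinom (- (k.+1)%:Z) t.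
  by rewrite e addrK.
apply: laurentD => //; apply/laurentN.
by apply: laurentM; [apply: laurent_v|apply: IH].
Qed.

Lemma horner_zgen b t a : (zgen v b t).[v ^ (- a)] = gbinom (a + b - 1) t.
Proof.
rewrite /zgen horner_prod; apply: eq_bigr => k _.
rewrite hornerM hornerC hornerD hornerN hornerZ hornerXn hornerC; congr ((_ - _) / _).
rewrite exprnP exprz_exp -expfzDr ?v_neq0 //; congr (_ ^ _); lia.
Qed.

Lemma zgen_in b t : Z (zgen v b t).
Proof.
case: t => [|t]; last exact: Zgen.
by rewrite /zgen big_ord0; apply: laurent1.
Qed.

Lemma zgen_comp b t : exists2 H : {poly K}, zgen v b t = H \Po 'X^2 & (size H <= t.+1)%N.
Proof.
elim: t => [|t [H HE sH]]; first by exists 1; rewrite ?size_poly1 // comp_polyC /zgen big_ord0.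
pose f : {poly K} := (v ^ (- 2 * (b - (t.+1)%:Z)) *: 'X - 1) * ((v ^ (- 2 * (t.+1)%:Z) - 1)^-1)%:P.
exists (H * f).
  rewrite /zgen big_ord_recr /= -/(zgen v b t) HE !comp_polyM !rmorphB /=.
  by rewrite comp_polyZ comp_polyX !comp_polyC.
have sf : (size f <= 2)%N.
  rewrite /f mulrC mul_polyC (leq_trans (size_scale_leq _ _)) //.
  rewrite (leq_trans (size_polyD _ _)) // geq_max size_polyN size_poly1 andbT.
  by rewrite (leq_trans (size_scale_leq _ _)) // size_polyX.
apply: leq_trans (size_polyMleq H f) _; move: (size f) (size H) sf sH => x y; lia.
Qed.

Hypothesis laurent_eval : forall P, Z P -> forall a, laurent P.[v ^ (- a)].

(* The q-analogue of Polya's theorem on integer-valued polynomials: Newton interpolation at the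
   points [a0, a0 + 1, ...], where the Gaussian binomials [zgen v (1 - a0) t] are unitriangular. *)
Lemma newton_in (S : {poly K}) a0 :
  (forall a, a0 <= a -> laurent (S \Po 'X^2).[v ^ (- a)]) -> Z (S \Po 'X^2).
Proof.
move=> SL; pose N := size S.
have sq R a : (R \Po 'X^2).[v ^ (- a)] = R.[v ^ (- 2 * a)] :> K.
  by rewrite horner_comp hornerXn exprnP exprz_exp; congr (_.[_ ^ _]); lia.
have [t tN] : exists t, t = N by exists N.
have : (t <= N)%N -> exists R : {poly K}, [/\ Z (R \Po 'X^2), (size R <= N)%N &
   forall s : nat, (s < t)%N ->
     (R \Po 'X^2).[v ^ (- (a0 + s%:Z))] = (S \Po 'X^2).[v ^ (- (a0 + s%:Z))]].
  elim: t {tN} => [_|t IH tN].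
    by exists 0; split; rewrite ?size_poly0 // comp_poly0; apply: laurent0.
  have [|R [RZ sR Rs]] := IH; first exact: ltnW.
  (* At the node [a0 + s] this generator takes the value [gbinom s t]: 0 for [s < t] and 1 for
     [s = t]. Adding a multiple of it corrects the value at the new node and keeps the earlier
     ones. *)
  have [H HE sH] := zgen_comp (1 - a0) t.
  pose x := (S \Po 'X^2).[v ^ (- (a0 + t%:Z))] - (R \Po 'X^2).[v ^ (- (a0 + t%:Z))].
  exists (R + x%:P * H); split.
  - rewrite rmorphD rmorphM /= comp_polyC -HE; apply: ZD => //.
    apply: ZM; last exact: zgen_in.
    by apply: laurentD; [apply: SL; lia|apply/laurentN/laurent_eval].
  - rewrite (leq_trans (size_polyD _ _)) // geq_max sR mul_polyC.
    by rewrite (leq_trans (size_scale_leq _ _)) // (leq_trans sH).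
  move=> s st; rewrite rmorphD rmorphM /= comp_polyC hornerD hornerM hornerC -HE horner_zgen.
  have -> : a0 + s%:Z + (1 - a0) - 1 = s by lia.
  have [lt|le] := ltnP s t; first by rewrite gbinom_small // mulr0 addr0 Rs.
  have -> : s = t by lia.
  by rewrite gbinomnn mulr1 /x addrC subrK.
rewrite tN => /(_ (leqnn _))[R [RZ sR Rs]].
suff -> : S = R by [].
apply/eqP; rewrite -subr_eq0; apply/negPn/negP => d0.
(* In the variable v'^2 the difference has size at most [N] and yet [N] distinct roots, as [v] is
   not a root of unity. *)
pose rs := [seq v ^ (- 2 * (a0 + (s : nat)%:Z)) | s <- iota 0 N].
have ur : uniq rs.
  rewrite map_inj_uniq ?iota_uniq // => s s' e.
  have : v ^ (- 2 * (a0 + s%:Z) - (- 2 * (a0 + s'%:Z))) = 1.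
    by rewrite expfzDr ?v_neq0 // e -expfzDr ?v_neq0 // subrr.
  by move=> /vX_eq1; lia.
have ar : all (root (S - R)) rs.
  apply/allP => z /mapP[s]; rewrite mem_iota => /andP[_ sN] ->.
  by rewrite /root hornerD hornerN -!sq Rs ?subrr //; move: sN; lia.
have := max_poly_roots d0 ar ur; rewrite size_map size_iota ltnNge => /negP; apply.
by rewrite (leq_trans (size_polyD _ _)) // geq_max size_polyN sR leqnn.
Qed.

End Gauss.

Lemma inZ1_gen a t : (0 < t)%N -> inZ1 (zgen vv a t).
Proof. exact: Z1_gen. Qed.

Lemma inZ1_eval P : inZ1 P -> forall a, laurent inZ1 P.[vv ^ (- a)].
Proof.
elim=> [j|b t _|p q _ IHp _ IHq|p _ IHp|p q _ IHp _ IHq] a.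
- rewrite hornerC; exact: Z1_v.
- rewrite -[Z1gen b t]/(zgen vv b t) horner_zgen ?vv_neq0 //.
  exact: (laurent_gbinom vv_neq0 vvX_eq1 Z1_v Z1_add Z1_opp Z1_mul).
- rewrite hornerD; exact: (laurentD Z1_add (IHp a) (IHq a)).
- rewrite hornerN; exact: (laurentN Z1_opp (IHp a)).
- rewrite hornerM; exact: (laurentM Z1_mul (IHp a) (IHq a)).
Qed.

Lemma inZ1_of_values (S : {poly Qv}) a0 :
  (forall a, a0 <= a -> laurent inZ1 (S \Po 'X^2).[vv ^ (- a)]) -> inZ1 (S \Po 'X^2).
Proof.
exact: (newton_in vv_neq0 vvX_eq1 Z1_v inZ1_gen Z1_add Z1_opp Z1_mul inZ1_eval).
Qed.

(** * Stabilization *)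

(** Classical equality test on functions, so that lists of matrices can be freed of repetitions. *)
Definition mxZ_eqb (X Y : mxZ) : bool :=
  if excluded_middle_informative (X = Y) then true else false.

Lemma mxZ_eqP : Equality.axiom mxZ_eqb.
Proof. by move=> X Y; rewrite /mxZ_eqb; case: excluded_middle_informative => h; constructor. Qed.

HB.instance Definition _ := hasDecEq.Build mxZ mxZ_eqP.

Definition veval (g : {poly int}) : Qv := (map_poly (fun z : int => z%:~R : Qv) g).[vv ^+ 2].

Lemma veval_is_zmod_morphism : zmod_morphism veval.
Proof. by move=> c d; rewrite /veval rmorphB hornerD hornerN. Qed.
Lemma veval_is_monoid_morphism : monoid_morphism veval.
Proof. by split=> [|c d]; rewrite /veval ?rmorph1 ?hornerC // rmorphM hornerM. Qed.
HB.instance Definition _ :=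
  GRing.isZmodMorphism.Build {poly int} Qv veval veval_is_zmod_morphism.
HB.instance Definition _ :=
  GRing.isMonoidMorphism.Build {poly int} Qv veval veval_is_monoid_morphism.

Lemma vevalX : veval 'X = vv ^+ 2.
Proof. by rewrite /veval map_polyX hornerX. Qed.

(** The value at q = v^2 is the image of D(X^2), and a monic polynomial stays nonzero over the
    rationals. So the denominators remain invertible in Q(v). *)
Lemma veval_monic_neq0 (D : {poly int}) : D \is monic -> veval D != 0.
Proof.
move=> mD.
have -> : veval D = FracField.tofrac (map_poly (fun z : int => z%:~R : rat) D \Po 'X^2).
  elim/poly_ind: (D) => [|p c IH]; first by rewrite rmorph0 rmorph0 comp_poly0 tofrac0.
  rewrite rmorphD rmorphM /= vevalX IH rmorphD rmorphM /= map_polyX map_polyC.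
  rewrite rmorphD rmorphM /= comp_polyX comp_polyC tofracD tofracM tofracXn.
  congr (_ + _); rewrite /veval map_polyC hornerC /=.
  by rewrite -[c%:~R : rat]/(intr c) !rmorph_int.
rewrite tofrac_eq0 comp_poly_eq0 ?size_polyXn //; apply: monic_neq0.
exact: monic_map.
Qed.

(** * From stable families to structure constants *)

Section Final.
Variables m0 n0 : int.
Hypothesis le_mn0 : m0 <= n0.
Implicit Types m n i j h u : int.

(** Terms with the same matrix are merged. Their degree bounds coincide, since [w] and [len X]
    determine [k], so the merged coefficient keeps the bound. *)
Lemma stable_list s w T : stable m0 n0 s w T ->
  exists (S : seq mxZ) (phi : mxZ -> nat -> int -> rat),
    [/\ uniq S,
      forall X, X \in S -> [/\ inXiT m0 n0 X, sigmaZ m0 n0 X = s &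
        exists2 k : nat, w = len m0 n0 X + 2 * k%:Z & good k (phi X)] &
      eqfam m0 n0 T (fun F a m n r f1 f2 => \sum_(X <- S) phi X #|F| a * famM X a f1 f2)].
Proof.
elim=> {w T} [w|w X k phi XX sX wE gphi
  |w T1 T2 _ [S1 [phi1 [u1 p1 e1]]] _ [S2 [phi2 [u2 p2 e2]]]|w T T' eT _ [S [phi [u p e]]]].
- by exists [::], (fun _ _ _ => 0); split=> // F a m n r f1 f2 *; rewrite big_nil.
- exists [:: X], (fun _ => phi); split=> // [Y|F a m n r f1 f2 *]; last by rewrite big_seq1.
  by rewrite inE => /eqP->; split=> //; exists k.
- have part (S : seq mxZ) (U : seq mxZ) (f : mxZ -> rat) : uniq S -> uniq U -> {subset S <= U} ->
      \sum_(X <- U) (if X \in S then f X else 0) = \sum_(X <- S) f X.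
    move=> uS uU SU; rewrite -big_mkcond -big_filter; apply: perm_big; apply: uniq_perm => //.
      exact: filter_uniq.
    by move=> X; rewrite mem_filter; case XS: (X \in S) => //=; rewrite SU.
  exists (undup (S1 ++ S2)), (fun X q a => (if X \in S1 then phi1 X q a else 0)
      + (if X \in S2 then phi2 X q a else 0)).
  have good0 k : good k (fun _ _ => 0) by apply: good_le (good_const 0).
  split=> [|X|F a m n r f1 f2 mm nn ff1 ff2]; first exact: undup_uniq.
    rewrite mem_undup mem_cat; case X1: (X \in S1); case X2: (X \in S2) => // _.
    + have [XX sX [k wE gk]] := p1 X X1; have [_ _ [k' wE' gk']] := p2 X X2.
      split=> //; exists k => //; apply: good_add => //.
      by have -> : k = k' by lia.
    + by have [XX sX [k wE gk]] := p1 X X1; split=> //; exists k => //; apply: good_add.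
    + by have [XX sX [k wE gk]] := p2 X X2; split=> //; exists k => //; apply: good_add.
  rewrite e1 // e2 // -(part S1 (undup (S1 ++ S2))) ?undup_uniq //; last first.
    by move=> X XS; rewrite mem_undup mem_cat XS.
  rewrite -(part S2 (undup (S1 ++ S2))) ?undup_uniq //; last first.
    by move=> X XS; rewrite mem_undup mem_cat XS orbT.
  rewrite -big_split; apply: eq_bigr => X _ /=.
  by do 2!case: ifP => _; rewrite ?addr0 ?add0r ?mul0r // mulrDl.
- exists S, phi; split=> // F a m n r f1 f2 mm nn ff1 ff2.
  by rewrite eT // e.
Qed.

Lemma sigmaZ_ext a m n X : m <= m0 -> n0 <= n -> inXiT m0 n0 X ->
  sigmaZ m n (ext a m n X) = sigmaZ m0 n0 X + a * (n - m + 1).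
Proof.
move=> mm nn XX; have mn : m <= n by lia.
transitivity (\sum_(i <- rng m n) (\sum_(j <- rng m n) X i j + a)).
  apply: eq_big_seq => i; rewrite mem_rng // => hi.
  transitivity (\sum_(j <- rng m n) (X i j + if j == i then a else 0)); last first.
    by rewrite big_split /= sum_rng1 // hi.
  apply: eq_bigr => j _; by rewrite /ext hi andbT eq_sym.
rewrite big_split /= /sigmaZ (@sum2_rng_sub m0 n0 m n) //; last by move=> i j; apply: inXiT_out.
congr (_ + _); rewrite big_const_seq count_predT iter_addr_0 /rng size_map size_iota.
by rewrite -mulr_natr; congr (_ * _); lia.
Qed.

Lemma sigmaZ_co_ro A B : (forall j, inrng m0 n0 j -> coZ m0 n0 A j = roZ m0 n0 B j) ->
  sigmaZ m0 n0 A = sigmaZ m0 n0 B.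
Proof.
move=> AB; rewrite /sigmaZ exchange_big; apply: eq_big_seq => j.
by rewrite mem_rng // => /AB.
Qed.

Lemma inXi_ext a m n X : 0 <= a -> m <= m0 -> n0 <= n -> inXiT m0 n0 X ->
  (forall i, inrng m0 n0 i -> 0 <= X i i + a) ->
  inXi m n (sigmaZ m0 n0 X + a * (n - m + 1)) (ext a m n X).
Proof.
move=> a0 mm nn XX Xa; split=> [i j hij|]; last split=> [i j|]; last exact: sigmaZ_ext.
- rewrite /ext (inXiT_out XX) ?add0r; last by move: hij; rewrite /inrng; lia.
  by case: eqP hij => [->|//]; rewrite andbb => /negPf ->.
- rewrite /ext; case: (eqVneq i j) => [<-|ij] /=; last by rewrite addr0 XX.2.
  case hi: (inrng m0 n0 i); last first.
    by rewrite (inXiT_out XX) ?hi // add0r; case: ifP.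
  have -> : inrng m n i by move: hi; rewrite /inrng; lia.
  exact: Xa.
Qed.

Lemma inXi_eq m n r C C' : m <= n -> inXi m n r C -> inXi m n r C' ->
  eqZmx m n C C' -> C = C'.
Proof.
move=> mn [C0 _] [C0' _] /eqZmxP-/(_ mn) e; apply: mxZ_ext => i j.
case h: (inrng m n i && inrng m n j); last by rewrite C0 ?C0' ?h.
by case/andP: h => hi hj; apply: e.
Qed.

Lemma eqZmx_ext_eq a m n X Y C : m <= m0 -> n0 <= n -> inXiT m0 n0 X -> inXiT m0 n0 Y ->
  eqZmx m n (ext a m n X) C -> eqZmx m n (ext a m n Y) C -> X = Y.
Proof.
move=> mm nn XX YY; have mn : m <= n by lia.
move=> /eqZmxP-/(_ mn) e /eqZmxP-/(_ mn) e'; apply: mxZ_ext => i j.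
case h: (inrng m0 n0 i && inrng m0 n0 j); last by rewrite (inXiT_out XX) ?(inXiT_out YY) ?h.
have := e i j; have := e' i j; rewrite /ext => h1 h2.
have hi : inrng m n i by move: h; rewrite /inrng; lia.
have hj : inrng m n j by move: h; rewrite /inrng; lia.
by apply: (@addIr _ (if (i == j) && inrng m n i then a else 0)); rewrite h2 ?h1.
Qed.

Section Expansion.
Variables (A B : mxZ) (S : seq mxZ) (phi : mxZ -> nat -> int -> rat).
Hypotheses (AA : inXiT m0 n0 A) (BB : inXiT m0 n0 B).
Hypothesis SX : forall X, X \in S -> inXiT m0 n0 X.
Hypothesis AB : eqfam m0 n0 (famC (famM A) (famM B))
  (fun F a m n r f1 f2 => \sum_(X <- S) phi X #|F| a * famM X a f1 f2).

Lemma flagcount_expansion (F : finFieldType) a m n (r : nat) C :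
  m <= m0 -> n0 <= n -> inXi m n r%:Z C ->
  (flagcount m n r (ext a m n A) (ext a m n B) C F)%:R
  = \sum_(X <- S | eqZmx m n (ext a m n X) C) phi X #|F| a.
Proof.
move=> mm nn CC; have mn : m <= n by lia.
apply: flagcount_famC => // f1 f2 ff1 ff2 /eqZmxP-/(_ mn) tC.
rewrite AB // [RHS]big_mkcond; apply: eq_bigr => X _; rewrite /famM.
have -> : eqZmx m n (typ f1 f2) (ext a m n X) = eqZmx m n (ext a m n X) C.
  by apply/eqZmxP/eqZmxP => // e i j hi hj; [rewrite -e ?tC|rewrite tC ?e].
by case: ifP; rewrite ?mulr1 ?mulr0.
Qed.

Lemma Kcoef_eq0 a m n (r : nat) C :
  m <= m0 -> n0 <= n -> inXi m n r%:Z C ->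
  (forall X, X \in S -> ~~ eqZmx m n (ext a m n X) C) ->
  Kcoef m n r (ext a m n A) (ext a m n B) C = 0.
Proof.
move=> mm nn CC nS; rewrite /Kcoef.
have -> : gpoly m n r (ext a m n A) (ext a m n B) C = 0.
  rewrite -[LHS]mulr1; apply: gpoly_quotient; first exact: good_den1.
  move=> F; rewrite flagcount_expansion // rmorph0 mul0r big1_seq // => X /andP[e XS].
  by rewrite (negPf (nS X XS)) in e.
by rewrite rmorph0 horner0 mulr0.
Qed.

(** By [dmx_ext] the normalization contributes v^(-2 a k) up to a constant power of [v]. Multiplied
    by a polynomial of degree at most [k] in v^(2 a), it gives the polynomial with reversed
    coefficients in v^(-2 a). *)
Lemma Kcoef_uniq_poly X k : uniq S -> X \in S -> good k (phi X) ->
  len m0 n0 A + len m0 n0 B = len m0 n0 X + 2 * k%:Z ->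
  exists Q : {poly Qv}, forall a m n (r : nat), 0 <= a ->
    m <= m0 -> n0 <= n -> inXi m n r%:Z (ext a m n X) ->
    Kcoef m n r (ext a m n A) (ext a m n B) (ext a m n X) = (Q \Po 'X^2).[vv ^ (- a)].
Proof.
move=> uS XS [D [P [gD sP phiE]]] lE.
pose d := dmx m0 n0 X - dmx m0 n0 A - dmx m0 n0 B.
exists ((vv ^ d / veval D) *: \poly_(i < k.+1) veval P`_(k - i)).
move=> a m n r a0 mm nn CC; have mn : m <= n by lia.
rewrite /Kcoef -/(veval _) !(dmx_ext le_mn0 mm nn) //; last exact: SX.
have mono : D \is monic by case: gD.
(* For [a >= 0] the substitution of q^a in [P] is a polynomial in q, as [gpoly_quotient]
   requires. *)
have -> : veval (gpoly m n r (ext a m n A) (ext a m n B) (ext a m n X))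
    = veval P.['X^(absz a)] / veval D.
  apply: (canRL (mulfK (veval_monic_neq0 mono))).
  rewrite -rmorphM; congr (veval _); apply: gpoly_quotient => // F.
  rewrite flagcount_expansion // (big_rem X) //= (_ : eqZmx _ _ _ _); last exact/eqZmxP.
  rewrite big1_seq ?addr0 => [|Y /andP[e]]; last first.
    rewrite mem_rem_uniq // !inE => /andP[/eqP YX YS]; case: YX.
    by apply: (eqZmx_ext_eq mm nn (SX YS) (SX XS) e); apply/eqZmxP.
  rewrite phiE ?natr_q1 //; congr (_ / _).
  rewrite -[in RHS]horner_map /= rmorphXn /= qevalX; congr (_.[_]).
  by rewrite exprnP; congr (_ ^ _); lia.
rewrite horner_comp hornerZ horner_poly hornerXn -horner_map /=.
rewrite (horner_coef_wide (n := k.+1)); last exact: leq_trans (size_poly _ _) sP.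
have -> : dmx m0 n0 X + a * len m0 n0 X - (dmx m0 n0 A + a * len m0 n0 A)
   - (dmx m0 n0 B + a * len m0 n0 B) = d + - 2 * a * k%:Z.
  rewrite /d; have -> : len m0 n0 X = len m0 n0 A + len m0 n0 B - 2 * k%:Z by lia.
  ring.
rewrite expfzDr ?vv_neq0 //; set c := vv ^ d; set e := vv ^ (- 2 * a * k%:Z).
rewrite -[LHS]mulrA -[RHS]mulrA; congr (_ * _).
rewrite [RHS]mulrC [LHS]mulrA; congr (_ * _).
rewrite mulr_sumr (reindex_inj rev_ord_inj) /=; apply: eq_bigr => i _.
have ik : (i <= k)%N by rewrite -ltnS.
rewrite subSS coef_map /= mulrCA; congr (_ * _).
rewrite /e rmorphXn /= vevalX !exprnP !exprz_exp -expfzDr ?vv_neq0 //; congr (_ ^ _).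
rewrite -subzn // (_ : (absz a)%:Z = a); [ring|lia].
Qed.

End Expansion.
End Final.

Theorem theorem3p4 (m0 n0 : int) (A B : mxZ) :
  m0 <= n0 ->
  inXiT m0 n0 A -> inXiT m0 n0 B ->
  (forall j, inrng m0 n0 j -> coZ m0 n0 A j = roZ m0 n0 B j) ->
  exists (s : nat) (X : 'I_s -> mxZ) (P : 'I_s -> {poly Qv}) (a0 : int),
    [/\ forall i, inXiT m0 n0 (X i),
        forall i, inZ1 (P i),
        0 <= a0 &
        forall a m n : int, a0 <= a -> m <= m0 -> n0 <= n ->
          let r := sigmaZ m0 n0 A + a * (n - m + 1) in
          (forall i, inXi m n r (ext a m n (X i))) /\
          (forall C : mxZ, inXi m n r C ->
             Kcoef m n (absz r) (ext a m n A) (ext a m n B) C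
             = \sum_(i < s | eqZmx m n (ext a m n (X i)) C) (P i).[vv ^ (- a)])].
Proof.
move=> mn0 AA BB AB.
have [S [phi [uS SP SE]]] := stable_list mn0 (famC_stable mn0 AA BB AB).
have SX X : X \in S -> inXiT m0 n0 X by move=> /SP[].
pose X (i : 'I_(size S)) := tnth (in_tuple S) i.
have XS i : X i \in S by apply: mem_tnth.
(* A bound for all diagonal entries of the matrices in [S]: from [a0] on, every [ext a m n Y] is
   nonnegative. *)
pose a0 : int := \sum_(Y <- S) \sum_(i <- rng m0 n0) `|Y i i|.
have a0_ge Y i : Y \in S -> inrng m0 n0 i -> `|Y i i| <= a0.
  move=> YS hi; rewrite /a0 (big_rem Y) //= (bigD1_seq i) ?rng_uniq ?mem_rng //= -addrA.
  by rewrite lerDl addr_ge0 // sumr_ge0 // => Z _; apply: sumr_ge0.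
have a0_ge0 : 0 <= a0 by apply: sumr_ge0 => Y _; apply: sumr_ge0.
have sAB := sigmaZ_co_ro mn0 AB.
have Xinxi a m n Y : Y \in S -> a0 <= a -> m <= m0 -> n0 <= n ->
   inXi m n (sigmaZ m0 n0 A + a * (n - m + 1)) (ext a m n Y).
  move=> YS aa mm nn; have [YY sY _] := SP Y YS.
  rewrite sAB -sY; apply: inXi_ext => // [|i hi]; first exact: le_trans aa.
  by have := a0_ge Y i YS hi; lia.
have r_abs m n r C : inXi m n r C -> (absz r)%:Z = r.
  move=> [_ [Cp Cr]]; suff : 0 <= r by lia.
  by rewrite -Cr; apply: sumr_ge0 => i _; apply: sumr_ge0.
have exP (i : 'I_(size S)) : exists P : {poly Qv}, inZ1 P /\
    forall a m n, a0 <= a -> m <= m0 -> n0 <= n ->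
    Kcoef m n (absz (sigmaZ m0 n0 A + a * (n - m + 1))) (ext a m n A) (ext a m n B)
      (ext a m n (X i)) = P.[vv ^ (- a)].
  have [_ _ [k lE gk]] := SP _ (XS i).
  have [Q QE] := Kcoef_uniq_poly mn0 AA BB SX SE uS (XS i) gk lE.
  have QE' a m n : a0 <= a -> m <= m0 -> n0 <= n ->
    Kcoef m n (absz (sigmaZ m0 n0 A + a * (n - m + 1))) (ext a m n A) (ext a m n B)
      (ext a m n (X i)) = (Q \Po 'X^2).[vv ^ (- a)].
    move=> aa mm nn; apply: QE => //; first exact: le_trans aa.
    have Xi := Xinxi a m n _ (XS i) aa mm nn.
    by rewrite (r_abs _ _ _ _ Xi).
  (* Each value is a structure constant, a power of [v] times an integral polynomial in v^2. It is
     computed on [m0, n0], as it is the same for all larger intervals. *)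
  exists (Q \Po 'X^2); split=> //; apply: (@inZ1_of_values _ a0) => a aa.
  rewrite -(QE' a m0 n0) //; apply: (laurentM Z1_mul); first exact: Z1_v.
  by apply: (laurent_horner Z1_v Z1_add Z1_opp Z1_mul); exact: (Z1_v 2).
have [P PP] := fin_all_exists exP.
exists (size S), X, P, a0; split=> // [i|i|a m n aa mm nn r].
- exact/SX/XS.
- by case: (PP i).
have mn : m <= n by lia.
split=> [i|C CC]; first exact: Xinxi.
(* The matrices in [S] are distinct, so at most one index matches [C]; if none does, both sides
   vanish. *)
case: (pickP (fun i => eqZmx m n (ext a m n (X i)) C)) => [i iC|nC].
  have EC : ext a m n (X i) = C by apply: inXi_eq mn _ CC iC; apply: Xinxi.
  rewrite (big_pred1 i) => [|j]; first by have [_ PE] := PP i; rewrite -(PE a m n) // EC.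
  apply/idP/eqP => [jC|->//].
  apply/val_inj/eqP; rewrite /= -(nth_uniq A (ltn_ord j) (ltn_ord i) uS) //.
  have := eqZmx_ext_eq mn0 mm nn (SX _ (XS j)) (SX _ (XS i)) jC iC.
  by rewrite /X !(tnth_nth A) /= => ->.
rewrite big_pred0 //; apply: (Kcoef_eq0 mn0 SE) => //.
  by rewrite (r_abs _ _ _ _ CC).
by move=> Y /(tnthP (in_tuple S))[i ->]; rewrite nC.
Qed.
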